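(* Let $d\ge 1$, let $n_1,\dots,n_d$ be positive integers, and let $a_1\le a_2\le\cdots\le a_d$ be positive integers. Let $k=\max\{i \mid a_i=1\}$ (with $k=0$ if no $a_i$ equals $1$). Then: (i) if $k\ge 3$, the line bundle $\mathcal{O}_{\mathbf{P}^{n_1}\times\cdots\times\mathbf{P}^{n_d}}(a_1,\dots,a_d)$ does not satisfy Property $N_4$; (ii) if $d-k\ge 2$, the line bundle $\mathcal{O}_{\mathbf{P}^{n_1}\times\cdots\times\mathbf{P}^{n_d}}(a_1,\dots,a_d)$ does not satisfy Property $N_{2a_{k+1}+2a_{k+2}-2}$.
   Context: Everything is over $\mathbf{C}$. The line bundle $\mathcal{O}_{\mathbf{P}^{n_1}\times\cdots\times\mathbf{P}^{n_d}}(a_1,\dots,a_d)$ is the tensor product of the pullbacks of $\mathcal{O}_{\mathbf{P}^{n_i}}(a_i)$ from the factors. Property $N_p$ (Green–Lazarsfeld), $p\in\mathbf{N}=\{0,1,2,\dots\}$: let $Y$ be a smooth complex projective variety and $L$ a very ample line bundle on $Y$, defining an embedding $Y\hookrightarrow \mathbf{P}(H^0(Y,L)^* )$. Let $S=\mathrm{Sym}^* H^0(Y,L)$ be the homogeneous coordinate ring of this projective space, and let $G=\bigoplus_{n} H^0(Y,L^{n})$, a graded $S$-module. Let $$0\to E_n\to E_{n-1}\to\cdots\to E_0\to G\to 0$$ be a minimal graded free resolution of $G$ over $S$. Then $L$ satisfies Property $N_p$ if and only if $E_0=S$ and, for every $1\le i\le p$, $E_i$ is a (possibly zero) direct sum of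 copies of $S(-i-1)$. *)

(* Defs.v *)
From HB Require Import structures.
From mathcomp Require Import all_boot all_order all_algebra.
From mathcomp Require Import reals complex mpoly.

Set Implicit Arguments.
Unset Strict Implicit.
Unset Printing Implicit Defensive.

Import Order.TTheory GRing.Theory Num.Theory.
Local Open Scope ring_scope.

(** * Line bundles on products of projective spaces

    A point of P^{n_0} x ... x P^{n_{d-1}} is given by homogeneous coordinates,
    that is, by a d-tuple of nonzero vectors, up to scaling each vector by a
    nonzero scalar lam_i.  A section of O(a_0, ..., a_{d-1}) is a regular function on the
    set of such tuples that this scaling multiplies by the character
    prod_i lam_i ^ a_i: for d = 1 these are the sections of O(a), and the
    exterior tensor product of line bundles multiplies the characters. *)

Section Sections.
Variables (K : closedFieldType) (d : nat) (n : 'I_d -> nat).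

Definition hcoord : Type :=
  {x : forall i : 'I_d, 'rV[K]_(n i).+1 | [forall i, x i != 0]}.

Definition nvars : nat := #|{: {i : 'I_d & 'I_(n i).+1}}|.

Definition coords (x : hcoord) (v : 'I_nvars) : K :=
  sval x (tag (enum_val v)) 0 (tagged (enum_val v)).

(* The sets where a polynomial q does not vanish are a basis of the Zariski
   topology, and a fraction defined on a smaller neighbourhood D(q') can be
   rewritten with a denominator divisible by q'. *)
Definition regular (s : hcoord -> K) : Prop :=
  forall x : hcoord, exists p q : {mpoly K[nvars]},
    q.@[coords x] != 0 /\
    forall y : hcoord, q.@[coords y] != 0 ->
      s y = p.@[coords y] / q.@[coords y].

Definition equivariant (a : 'I_d -> int) (s : hcoord -> K) : Prop :=
  forall (lam : 'I_d -> K) (x y : hcoord),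
    (forall i, lam i != 0) ->
    (forall i, sval y i = lam i *: sval x i) ->
    s y = (\prod_(i < d) lam i ^ a i) * s x.

Definition section (a : 'I_d -> int) (s : hcoord -> K) : Prop :=
  regular s /\ equivariant a s.

(* The sections of the m-th tensor power of O(a). *)
Definition section_ring (a : 'I_d -> nat) (m : int) : (hcoord -> K) -> Prop :=
  section (fun i => m * (a i)%:Z).

End Sections.

(** * Property N_p

    [G m] is the space of sections of L^m, realised as functions on a set X;
    multiplication of sections is multiplication of functions.  Given a basis
    sigma_0, ..., sigma_{N-1} of [G 1] = H^0(L), the symmetric algebra S of
    H^0(L) is {mpoly K[N]}, and f in S acts on the sections as multiplication
    by f(sigma_0, ..., sigma_{N-1}). *)

Section PropertyN.
Variables (K : fieldType) (X : Type) (G : int -> (X -> K) -> Prop).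

Definition is_basis (N : nat) (sigma : 'I_N -> X -> K) : Prop :=
  (forall j, G 1 (sigma j)) /\
  (forall s, G 1 s ->
     exists! c : 'rV[K]_N, s =1 (fun x => \sum_(j < N) c 0 j * sigma j x)).

(* Zero is homogeneous of every degree, and is the only polynomial that is
   homogeneous of a negative degree. *)
Definition homogeneous (N : nat) (e : int) (f : {mpoly K[N]}) : Prop :=
  forall m, m \in msupp f -> (mdeg m)%:Z = e.

(* [v] lies in the degree m part of the direct sum of the S(- delta k). *)
Definition in_degree (N b : nat) (delta : 'I_b -> int) (m : int)
    (v : 'rV[{mpoly K[N]}]_b) : Prop :=
  forall k, homogeneous (m - delta k) (v 0 k).

(* The map from a free S-module sending the k-th basis vector to [g k]. *)
Definition augment (N b : nat) (sigma : 'I_N -> X -> K) (g : 'I_b -> X -> K)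
    (v : 'rV[{mpoly K[N]}]_b) (x : X) : K :=
  \sum_(k < b) (v 0 k).@[fun j => sigma j x] * g k x.

(* E_i is the direct sum over k of the S(- shift i k), and its elements are row
   vectors; [diff i] is the matrix of E_{i+1} -> E_i.  As all the maps are
   graded, exactness is required in every degree. *)
Record minimal_resolution (N : nat) (sigma : 'I_N -> X -> K) :=
  MinimalResolution {
  rk : nat -> nat;
  shift : forall i, 'I_(rk i) -> int;
  diff : forall i, 'M[{mpoly K[N]}]_(rk i.+1, rk i);
  aug : 'I_(rk 0) -> X -> K;
  rk_finite : exists l : nat, forall i, (l < i)%N -> rk i = 0%N;
  diff_graded : forall i j k,
    homogeneous (shift j - shift k) (diff i j k);
  aug_graded : forall k, G (shift k) (aug k);
  aug_surjective : forall m s, G m s ->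
    exists2 v, in_degree (@shift 0) m v & s =1 augment sigma aug v;
  exact_at_0 : forall m (v : 'rV_(rk 0)), in_degree (@shift 0) m v ->
    (augment sigma aug v =1 (fun=> 0) <->
     exists2 w, in_degree (@shift 1) m w & v = w *m diff 0);
  exact_at_S : forall i m (v : 'rV_(rk i.+1)), in_degree (@shift i.+1) m v ->
    (v *m diff i = 0 <->
     exists2 w, in_degree (@shift i.+2) m w & v = w *m diff i.+1);
  (* the image of E_{i+1} lies in (sigma_0, ..., sigma_{N-1}) E_i *)
  minimal : forall i j k, (diff i j k)@_0%MM = 0
}.

(* A minimal resolution is unique up to isomorphism, so it does not matter
   which basis and which resolution are used. *)
Definition propertyN (p : nat) : Prop :=
  exists (N : nat) (sigma : 'I_N -> X -> K) (E : minimal_resolution sigma),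
    [/\ is_basis sigma,
        rk E 0 = 1%N /\ (forall k : 'I_(rk E 0), shift k = 0)
      & forall i, (1 <= i <= p)%N ->
          forall k : 'I_(rk E i), shift k = (i.+1)%:Z].

End PropertyN.

(* The line bundle O(a_0, ..., a_{d-1}) on the product of the P^{n_i}
   satisfies Property N_p; meaningful when all the a_i are positive, that is,
   when the line bundle is very ample. *)
Definition line_bundle_propertyN (K : closedFieldType) (d : nat)
    (n a : 'I_d -> nat) (p : nat) : Prop :=
  propertyN (section_ring (K := K) (n := n) a) p.

(* Main.v *)
Require Import Defs.
From HB Require Import structures.
From mathcomp Require Import all_boot all_order all_algebra.
From mathcomp Require Import reals complex mpoly.
From mathcomp Require Import zify ring.

Set Implicit Arguments.
Unset Strict Implicit.
Unset Printing Implicit Defensive.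

Import Order.TTheory GRing.Theory Num.Theory.
Local Open Scope ring_scope.

(** Write V for H^0(L), G_m for H^0(L^m) and (x) for the tensor product.  The
    theorem is obtained by exhibiting a class in the Koszul cohomology group
    K_(p,2), the homology of
    [[
      Lambda^(p+1) V (x) G_1 --> Lambda^p V (x) G_2 --> Lambda^(p-1) V (x) G_3,
    ]]
    which Property N_p forces to vanish.

    _Vanishing._  Under N_p no generator of E_0, ..., E_p has degree p+2.  In
    characteristic 0 the Koszul complex of a free module S(-e) is contractible in
    every total degree other than e, by Euler's formula for homogeneous
    polynomials ([koszul_contraction], [linform_koszul_exact]).  Chasing a
    cycle of total degree p+2 through the resolution, one syzygy module at a time,
    shows that it is a boundary ([syzygy_koszul_exact], [koszul_vanishing]).

    _The class._  Choose a set B of factors.  In the box of exponents of the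
    monomials of multidegree a, the path that climbs along all directions of B
    and then descends along them in the same order is a closed polygon made of
    edges of the box; it passes through D = 2 * sum_(r in B) a_r lattice points.
    Each edge of length a_r is a line P^1 in the product, embedded by L as a
    rational normal curve of degree a_r, so the polygon is a cycle of rational
    curves of degree D spanning a P^(D-1): a degenerate elliptic normal curve.
    Elliptic normal curves of degree D have K_(D-2,2) of dimension 1.  The class
    of the cycle lifts to the whole product as soon as one more monomial o of
    multidegree a, off the polygon, can replace the removed vertices; it has
    only two nonzero exponents, both equal to 1, in the first and the last
    direction of B, with respect to one coordinate of each factor
    ([cut_chain], [koszul_class]).

    _Nontriviality._  A basis of V is chosen that consists of the D monomials of
    the polygon, of o, and of sections vanishing on all its edges
    ([cycle_basis]).  If the class were the boundary of a chain, comparing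
    coefficients on the line through the i-th and the next lattice point would
    relate two coefficients b_i and b_(i+1) of that chain: b_1 + b_0 is 1 or -1,
    b_(i+1) = - b_i for 0 < i < D - 1, and the last relation, between b_(D-1) and
    b_0, then amounts to b_1 + b_0 = 0 ([edge_relation]), which is absurd
    ([koszul_class_not_boundary]).  All that is used about an arbitrary section is
    that its restrictions to lines are binary forms ([section_on_line]).

    Hence N_p fails for p = D - 2 whenever the monomial o lies off the polygon,
    which holds if B has at least three elements or consists of two directions
    with a_r > 1 ([product_not_propertyN]).  Three directions with a_r = 1 give
    p = 4, and two directions give p = 2 a_r + 2 a_s - 2. *)

(** * The Koszul differential *)

Section Koszul.
Variable N : nat.
Implicit Types (F : {set 'I_N}) (t u : 'I_N).

(** The sign of [t] in the exterior monomial indexed by [t |: F] is the parity of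
    this number. *)
Definition nbefore t F : nat := #|[set u in F | (u < t)%N]|.

Lemma nbeforeU1 t u F : t \notin F ->
  nbefore u (t |: F) = ((t < u) + nbefore u F)%N.
Proof.
move=> tF; rewrite /nbefore; case: ltnP => tu.
  have -> : [set v in t |: F | (v < u)%N] = t |: [set v in F | (v < u)%N].
    by apply/setP=> v; rewrite !inE; case: eqVneq => [->|_]; rewrite ?tu.
  by rewrite cardsU1 inE (negbTE tF).
rewrite add0n; apply: eq_card => v; rewrite !inE.
by case: eqVneq => [->|_]; rewrite // [(t < u)%N]ltnNge tu !andbF.
Qed.

Lemma nbeforeD1 t u F : t \in F ->
  nbefore u F = ((t < u) + nbefore u (F :\ t))%N.
Proof. by move=> tF; rewrite -{1}(setD1K tF) nbeforeU1 // setD11. Qed.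

Section Differential.
Variables (R : comNzRingType) (M : lmodType R).
Implicit Types (l : 'I_N -> R) (f : {set 'I_N} -> M).

(** An element of the k-th exterior power of the free module on ['I_N], with
    coefficients in [M], is stored as a function on all sets of which only the
    values at k-element sets matter; chains of all degrees then share one type. *)
Definition koszul l f F : M :=
  \sum_(t | t \notin F) (-1) ^+ nbefore t F *: (l t *: f (t |: F)).

Lemma koszulE l f F :
  koszul l f F = \sum_(t | t \notin F) ((-1) ^+ nbefore t F * l t) *: f (t |: F).
Proof. by apply: eq_bigr => t _; rewrite scalerA. Qed.

Lemma eq_koszul l f g F : (forall t, t \notin F -> f (t |: F) = g (t |: F)) ->
  koszul l f F = koszul l g F.
Proof. by move=> fg; apply: eq_bigr => t tF; rewrite fg. Qed.

Lemma koszulDl l l' f F :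
  koszul (fun t => l t + l' t) f F = koszul l f F + koszul l' f F.
Proof.
by rewrite -big_split; apply: eq_bigr => t _; rewrite scalerDl scalerDr.
Qed.

Lemma koszulB l f g F :
  koszul l (fun F' => f F' - g F') F = koszul l f F - koszul l g F.
Proof.
by rewrite -sumrN -big_split; apply: eq_bigr => t _; rewrite !scalerBr.
Qed.

Lemma koszulZ l c f F : koszul l (fun F' => c *: f F') F = c *: koszul l f F.
Proof.
rewrite scaler_sumr; apply: eq_bigr => t _; rewrite !scalerA.
by congr (_ *: _); ring.
Qed.

(** Removing [t] first and then [u], or the other way round, produces the
    same term with opposite signs. *)
Lemma koszulK l f F : koszul l (koszul l f) F = 0.
Proof.
pose G t u : M := ((-1) ^+ nbefore t F * l t) *:
   (((-1) ^+ nbefore u (t |: F) * l u) *: f (u |: (t |: F))).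
have GC t u : t != u -> t \notin F -> u \notin F -> G u t = - G t u.
  move=> tu tF uF; rewrite /G !scalerA setUCA -scaleNr; congr (_ *: _).
  rewrite !nbeforeU1 // !exprD.
  case: (ltngtP t u) => [tlu|ult|/val_inj E]; last by rewrite E eqxx in tu.
    by rewrite expr1 expr0; ring.
  by rewrite expr1 expr0; ring.
have -> : koszul l (koszul l f) F = \sum_(p : 'I_N * 'I_N |
    [&& p.1 != p.2, p.1 \notin F & p.2 \notin F]) G p.1 p.2.
  rewrite koszulE (eq_bigr (fun t => \sum_(u | u \notin t |: F) G t u)).
    rewrite pair_big_dep /=; apply: eq_bigl => -[t u] /=.
    by rewrite !inE negb_or eq_sym andbCA.
  by move=> t tF; rewrite koszulE scaler_sumr.
rewrite (bigID (fun p : 'I_N * 'I_N => (p.1 < p.2)%N)) /=.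
rewrite [X in _ + X](reindex (fun p : 'I_N * 'I_N => (p.2, p.1))) /=; last first.
  by exists (fun p => (p.2, p.1)) => -[].
rewrite [X in _ + X](eq_bigl (fun p : 'I_N * 'I_N =>
   [&& p.1 != p.2, p.1 \notin F & p.2 \notin F] && (p.1 < p.2)%N)); last first.
  move=> [t u] /=; rewrite -leqNgt eq_sym leq_eqVlt val_eqE.
  by case: eqVneq => //= _; rewrite [(t \notin F) && _]andbC.
rewrite -big_split big1 //= => -[t u] /= /andP[/and3P[tu tF uF] _].
by rewrite (GC t u) // addrN.
Qed.

End Differential.

(** Used for matrices over the polynomial ring, for the entries of a row vector,
    and for the evaluation of polynomials at the values of sections. *)
Lemma koszul_semilinear (R R' : comNzRingType) (rho : {rmorphism R -> R'})
    (M : lmodType R) (M' : lmodType R') (phi : M -> M') l f F :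
    (forall c v v', phi (c *: v + v') = rho c *: phi v + phi v') ->
  phi (koszul l f F) = koszul (rho \o l) (phi \o f) F.
Proof.
move=> philin.
have phi0 : phi 0 = 0.
  have := philin 1 0 0; rewrite scaler0 addr0 rmorph1 scale1r => /esym /eqP.
  by rewrite -subr_eq0 addrK => /eqP.
have phiD v v' : phi (v + v') = phi v + phi v'.
  by rewrite -[v]scale1r philin rmorph1 !scale1r.
have phiZ c v : phi (c *: v) = rho c *: phi v.
  by rewrite -[c *: v]addr0 philin phi0 addr0.
rewrite /koszul (big_morph phi phiD phi0); apply: eq_bigr => t _ /=.
by rewrite !phiZ rmorph_sign.
Qed.

Section Contraction.
Variables (R : comNzRingType) (l : 'I_N -> R) (D : 'I_N -> {additive R -> R}).
Hypothesis D_dual : forall t u f, D t (l u * f) = (t == u)%:R * f + l u * D t f.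

Definition contraction (f : {set 'I_N} -> R) F : R :=
  \sum_(t in F) (-1) ^+ nbefore t F * D t (f (F :\ t)).

(** When the [D t] are derivations dual to the [l t], the first sum on the right
    is the Euler operator: d h + h d multiplies by the total degree, the
    polynomial degree plus the exterior one.  All the terms that exchange an
    element of [F] for another one cancel between d h and h d. *)
Lemma koszul_contraction (f : {set 'I_N} -> R^o) F :
  koszul l (contraction f : _ -> R^o) F + contraction (koszul l f) F =
  \sum_t l t * D t (f F) + #|F|%:R * f F.
Proof.
have D_sign t n x : D t ((-1) ^+ n * x) = (-1) ^+ n * D t x.
  by rewrite -signr_odd; case: odd; rewrite ?mul1r ?expr0 ?expr1 ?mulN1r ?mul1r ?raddfN.
pose G t u : R := (-1) ^+ nbefore t F * (-1) ^+ nbefore u (t |: F) *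
   (l t * D u (f ((t |: F) :\ u))).
have E1 : koszul l (contraction f : _ -> R^o) F =
   \sum_(t | t \notin F) l t * D t (f F) +
   \sum_(t | t \notin F) \sum_(u in F) G t u.
  rewrite -big_split; apply: eq_bigr => t tF /=.
  rewrite /contraction (bigD1 t) ?setU11 //= setU1K //.
  rewrite nbeforeU1 // ltnn add0n /GRing.scale /= !mulrDr; congr (_ + _).
    by rewrite mulrCA signrMK.
  rewrite !mulr_sumr; apply: eq_big => u.
    by rewrite !inE; case: eqVneq => //= [->|]; rewrite ?(negbTE tF) ?andbT.
  by move=> _; rewrite /G; ring.
have E2 : contraction (koszul l f) F =
   \sum_(u in F) (f F + l u * D u (f F)) -
   \sum_(t | t \notin F) \sum_(u in F) G t u.
  rewrite exchange_big -sumrN -big_split; apply: eq_bigr => u uF /=.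
  rewrite /koszul raddf_sum (bigD1 u) ?setD11 //= mulrDr; congr (_ + _).
    rewrite /GRing.scale /= D_sign setD1K // mulrA -exprD.
    rewrite (nbeforeD1 u uF) ltnn add0n addnn -mul2n exprM sqrrN expr1n expr1n.
    by rewrite !mul1r D_dual eqxx mul1r.
  rewrite mulr_sumr -sumrN; apply: eq_big => t.
    by rewrite !inE; case: eqVneq => //= [->|]; rewrite ?uF ?andbT.
  rewrite !inE => /andP[tF tu]; rewrite (negbTE tu) /= in tF.
  rewrite /GRing.scale /= D_sign D_dual [u == t]eq_sym (negbTE tu) mul0r add0r.
  rewrite /G; have -> : (t |: F) :\ u = t |: F :\ u.
    by apply/setP => v; rewrite !inE; case: eqVneq => //= ->; rewrite eq_sym (negbTE tu).
  rewrite (nbeforeD1 u uF) (nbeforeD1 t uF) ltnn (nbeforeU1 u tF).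
  rewrite (nbeforeD1 u uF) ltnn !exprD expr0.
  case: (ltngtP t u) => [tlu|ult|/val_inj E]; last by rewrite E eqxx in tu.
    by rewrite expr1 expr0; ring.
  by rewrite expr1 expr0; ring.
rewrite E1 E2 addrACA subrr addr0 big_split /= sumr_const mulr_natl addrCA addrC.
congr (_ + _); rewrite [RHS](bigID (mem F)) addrC /=.
by congr (_ + _); apply: eq_bigl => t.
Qed.

End Contraction.
End Koszul.

(** * Linear forms and dual derivations *)

Section LinearForms.
Variables (K : numFieldType) (N : nat).
Implicit Types (f g : {mpoly K[N]}) (e : int) (F : {set 'I_N}).

Lemma homogeneousP e f :
  homogeneous e f <-> forall m, f@_m != 0 -> (mdeg m)%:Z = e.
Proof. by split=> H m; [rewrite -mcoeff_msupp | rewrite mcoeff_msupp]; apply: H. Qed.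

Lemma homogeneous0 e : homogeneous e (0 : {mpoly K[N]}).
Proof. by apply/homogeneousP => m; rewrite mcoeff0 eqxx. Qed.

Lemma homogeneousD e f g : homogeneous e f -> homogeneous e g -> homogeneous e (f + g).
Proof.
by move=> hf hg m /msuppD_le; rewrite mem_cat => /orP[/hf|/hg].
Qed.

Lemma homogeneousZ e c f : homogeneous e f -> homogeneous e (c *: f).
Proof. by move=> hf m /msuppZ_le /hf. Qed.

Lemma homogeneousM e1 e2 f g :
  homogeneous e1 f -> homogeneous e2 g -> homogeneous (e1 + e2) (f * g).
Proof.
move=> hf hg m /msuppM_le /allpairsP[[m1 m2] /= [/hf <- /hg <- ->]].
by rewrite mdegD PoszD.
Qed.

Lemma homogeneous_sum e (I : Type) (r : seq I) (P : pred I) (G : I -> {mpoly K[N]}) :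
  (forall i, P i -> homogeneous e (G i)) -> homogeneous e (\sum_(i <- r | P i) G i).
Proof.
move=> hG; elim/big_ind: _ => // [|f g]; [exact: homogeneous0 | exact: homogeneousD].
Qed.

Lemma homogeneous_mderiv e i f : homogeneous e f -> homogeneous (e - 1) f^`M(i).
Proof.
move=> hf; apply/homogeneousP => m; rewrite mcoeff_mderiv => nz.
have /hf <- : (m + U_(i))%MM \in msupp f.
  by rewrite mcoeff_msupp; apply: contraNneq nz => ->; rewrite mul0rn.
by rewrite mdegD mdeg1 PoszD addrK.
Qed.

Lemma homogeneous_const e f : homogeneous e f -> e = 0 -> f = (f@_0%MM)%:MP.
Proof.
move=> hf e0; apply/mpolyP => m; rewrite mcoeffC.
case: eqVneq => [->|m0]; rewrite ?mulr1 ?mulr0 //.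
apply: contraNeq m0 => /(homogeneousP _ _).1; rewrite -mdeg_eq0 => /(_ _ hf).
by rewrite e0 => -[->].
Qed.

Lemma mpoly_euler e f : homogeneous e f ->
  \sum_j 'X_j * f^`M(j) = e%:~R *: f.
Proof.
move=> hf; rewrite [in RHS](mpolyE f) scaler_sumr.
under eq_bigr => j _ do rewrite [X in mderiv _ X](mpolyE f) linear_sum mulr_sumr.
rewrite exchange_big big_seq [RHS]big_seq; apply: eq_bigr => m /hf <- /=.
rewrite (eq_bigr (fun j => f@_m *: ((m j)%:R *: 'X_[m]))) => [|j _].
  rewrite -scaler_sumr -scaler_suml -natr_sum -mdegE scalerA scalerA.
  by rewrite mulrC pmulrn.
rewrite linearZ /= mderivX -scalerAr -scalerAr; congr (_ *: _).
have [->|mj] := eqVneq (m j) 0%N; first by rewrite !scale0r.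
rewrite -mpolyXD addmC submK //; apply/mnm_lepP => i; rewrite mnm1E.
by case: eqVneq => // <-; rewrite lt0n.
Qed.

Section DualSystem.
Variables B C : 'M[K]_N.
Hypotheses (BC : B *m C = 1%:M) (CB : C *m B = 1%:M).

(** The rows of [B] are the coordinates of a new basis of the space of linear
    forms; the columns of its inverse [C] give the dual derivations. *)
Definition linform (t : 'I_N) : {mpoly K[N]} := \sum_j B t j *: 'X_j.

Definition linderiv (t : 'I_N) f : {mpoly K[N]} := \sum_j C j t *: f^`M(j).

Fact linderiv_is_linear t : linear (linderiv t).
Proof.
move=> c f g; rewrite /linderiv scaler_sumr -big_split; apply: eq_bigr => j _ /=.
by rewrite linearP scalerDr !scalerA mulrC.
Qed.

HB.instance Definition _ t :=
  GRing.isLinear.Build K {mpoly K[N]} {mpoly K[N]} _ (linderiv t) (linderiv_is_linear t).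

Lemma homogeneous_linform t : homogeneous 1 (linform t).
Proof.
apply: homogeneous_sum => j _; apply: homogeneousZ => m.
by rewrite msuppX inE => /eqP ->; rewrite mdeg1.
Qed.

Lemma homogeneous_linderiv e t f : homogeneous e f -> homogeneous (e - 1) (linderiv t f).
Proof.
by move=> hf; apply: homogeneous_sum => j _; apply: homogeneousZ; apply: homogeneous_mderiv.
Qed.

Lemma linderiv_dual t u f :
  linderiv t (linform u * f) = (t == u)%:R * f + linform u * linderiv t f.
Proof.
have dl j : (linform u)^`M(j) = (B u j)%:MP.
  rewrite /linform linear_sum (bigD1 j) //= big1 => [|i ij].
    rewrite addr0 linearZ /=.
    have -> : 'X_j^`M(j) = 1 :> {mpoly K[N]}.
      rewrite mderivX mnm1E eqxx scale1r (_ : (_ - _)%MM = 0%MM) ?mpolyX0 //.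
      by apply/mnmP => i; rewrite mnmBE subnn mnm0E.
    by rewrite alg_mpolyC.
  by rewrite linearZ /= mderivX mnm1E (negbTE ij) scale0r scaler0.
rewrite /linderiv mulr_sumr.
under eq_bigr => j _ do rewrite mderivM dl scalerDr.
rewrite big_split /=; congr (_ + _); last first.
  by apply: eq_bigr => j _; rewrite scalerAr.
have /matrixP /(_ u t) := BC; rewrite !mxE => E.
under eq_bigr => j _ do rewrite scalerAl -mul_mpolyC -mpolyCM mulrC.
by rewrite -mulr_sumr -rmorph_sum mulrC eq_sym /=; under eq_bigr do rewrite mulrC;
   rewrite E mpolyC_nat.
Qed.

Lemma linform_euler e f : homogeneous e f ->
  \sum_t linform t * linderiv t f = e%:~R *: f.
Proof.
move=> /mpoly_euler <-.
transitivity (\sum_j \sum_k \sum_t (B t j * C k t) *: ('X_j * f^`M(k))).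
  under eq_bigr => t _ do rewrite mulr_suml.
  rewrite exchange_big; apply: eq_bigr => j _.
  rewrite [RHS]exchange_big; apply: eq_bigr => t _; rewrite mulr_sumr.
  by apply: eq_bigr => k _; rewrite -scalerAl -scalerAr scalerA.
apply: eq_bigr => j _; rewrite (bigD1 j) //= [X in _ + X]big1 ?addr0 => [|k kj].
  rewrite -scaler_suml; have /matrixP /(_ j j) := CB; rewrite !mxE eqxx => E.
  by under eq_bigr do rewrite mulrC; rewrite E scale1r.
rewrite -scaler_suml; have /matrixP /(_ k j) := CB; rewrite !mxE (negbTE kj) => E.
by under eq_bigr do rewrite mulrC; rewrite E scale0r.
Qed.

Lemma linear_linform f : homogeneous 1 f ->
  f = \sum_u (linderiv u f)@_0%MM *: linform u.
Proof.
move=> hf; have := linform_euler hf; rewrite scale1r => {1}<-.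
apply: eq_bigr => u _; rewrite {1}[linderiv u f](homogeneous_const (e := 0)) //.
  by rewrite mulrC mul_mpolyC.
by have := homogeneous_linderiv (t := u) hf; rewrite subrr.
Qed.

(** On a cycle of total degree [e] the relation d h + h d = e reduces to
    d h = e, so that dividing the contraction by [e] gives a primitive. *)
Lemma linform_koszul_exact e j (f : {set 'I_N} -> {mpoly K[N]}^o) :
    e != 0 ->
    (forall F, #|F| = j -> homogeneous (e - j%:Z) (f F)) ->
    (forall F, #|F|.+1 = j -> koszul linform f F = 0) ->
  exists g : {set 'I_N} -> {mpoly K[N]}^o,
    (forall F, #|F| = j.+1 -> homogeneous (e - j.+1%:Z) (g F)) /\
    (forall F, #|F| = j -> koszul linform g F = f F).
Proof.
move=> e0 hf df; have eK : e%:~R != 0 :> K by rewrite intr_eq0.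
pose D t : {additive {mpoly K[N]} -> {mpoly K[N]}} := linderiv t.
pose h := contraction D.
exists (fun F => (e%:~R^-1)%:MP * h f F); split=> F Fj.
  rewrite mul_mpolyC; apply: homogeneousZ; apply: homogeneous_sum => t tF.
  have ht : homogeneous (e - j.+1%:Z) (linderiv t (f (F :\ t))).
    rewrite -addn1 PoszD opprD addrA; apply/homogeneous_linderiv/hf.
    by apply: succn_inj; rewrite -Fj (cardsD1 t F) tF.
  rewrite -signr_odd mulr_sign; case: odd => //.
  by rewrite -scaleN1r; apply: homogeneousZ.
rewrite (koszulZ (M := {mpoly K[N]}^o)).
have := koszul_contraction (D := D) linderiv_dual f F.
rewrite (linform_euler (hf _ Fj)) Fj [X in _ + X = _]big1 ?addr0 => [->|t tF]; last first.
  by rewrite [koszul _ _ _]df ?raddf0 ?mulr0 // -Fj (cardsD1 t F) tF.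
rewrite -mpolyC_nat mul_mpolyC -scalerDl -[j%:R]/(j%:Z%:~R) -rmorphD subrK.
by rewrite [_ *: _]mul_mpolyC scalerA mulVf // scale1r.
Qed.

End DualSystem.
End LinearForms.

(** * Koszul cohomology and minimal resolutions *)

Definition new_basis (K : pzRingType) (N : nat) (X : Type) (B : 'M[K]_N)
    (sigma : 'I_N -> X -> K) (t : 'I_N) (x : X) : K :=
  \sum_j B t j * sigma j x.

Section Vanishing.
Variables (K : numFieldType) (N : nat) (B C : 'M[K]_N).
Hypotheses (BC : B *m C = 1%:M) (CB : C *m B = 1%:M).
Implicit Types (F : {set 'I_N}) (b : nat) (m : int).

Notation S := {mpoly K[N]}.
Notation lin := (linform B).

Lemma in_degree0 b (delta : 'I_b -> int) m : in_degree delta m (0 : 'rV[S]_b).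
Proof. by move=> k; rewrite mxE; apply: homogeneous0. Qed.

Lemma in_degreeB b (delta : 'I_b -> int) m (v w : 'rV[S]_b) :
  in_degree delta m v -> in_degree delta m w -> in_degree delta m (v - w).
Proof.
move=> hv hw k; rewrite !mxE -scaleN1r.
by apply: homogeneousD (hv k) _; apply: homogeneousZ (hw k).
Qed.

Lemma in_degree_koszul b (delta : 'I_b -> int) m (f : {set 'I_N} -> 'rV[S]_b) F :
    (forall t, t \notin F -> in_degree delta (m - 1) (f (t |: F))) ->
  in_degree delta m (koszul lin f F).
Proof.
move=> hf k; rewrite summxE; apply: homogeneous_sum => t tF; rewrite !mxE.
rewrite -signr_odd mulr_sign.
have h : homogeneous (m - delta k) (lin t * f (t |: F) 0 k).
  have -> : m - delta k = 1 + (m - 1 - delta k) by ring.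
  by apply: homogeneousM; [apply: homogeneous_linform | apply: hf].
by case: odd => //; rewrite -scaleN1r; apply: homogeneousZ.
Qed.

Lemma in_degree_mulmx b b' (delta : 'I_b -> int) (delta' : 'I_b' -> int)
    (A : 'M[S]_(b, b')) m (v : 'rV[S]_b) :
    (forall i k, homogeneous (delta i - delta' k) (A i k)) ->
  in_degree delta m v -> in_degree delta' m (v *m A).
Proof.
move=> hA hv k; rewrite mxE; apply: homogeneous_sum => i _.
have -> : m - delta' k = (m - delta i) + (delta i - delta' k) by ring.
exact: homogeneousM (hv i) (hA i k).
Qed.

(** The component of [f] along a generator of degree [delta k] has total degree
    [m - delta k] over the polynomial ring. *)
Lemma free_koszul_exact b (delta : 'I_b -> int) m j (f : {set 'I_N} -> 'rV[S]_b) :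
    (forall k, delta k != m) ->
    (forall F, #|F| = j -> in_degree delta (m - j%:Z) (f F)) ->
    (forall F, #|F|.+1 = j -> koszul lin f F = 0) ->
  exists g : {set 'I_N} -> 'rV[S]_b,
    (forall F, #|F| = j.+1 -> in_degree delta (m - j.+1%:Z) (g F)) /\
    (forall F, #|F| = j -> koszul lin g F = f F).
Proof.
move=> hm hf df.
have entry (g : {set 'I_N} -> 'rV[S]_b) F k :
    (koszul lin g F) 0 k = koszul lin (fun F' => g F' 0 k : S^o) F.
  apply: (koszul_semilinear (rho := idfun) (M' := S^o) (phi := fun v : 'rV[S]_b => v 0 k)).
  by move=> c v w; rewrite !mxE.
have /fin_all_exists [g hg] : forall k : 'I_b, exists g : {set 'I_N} -> S^o,
    (forall F, #|F| = j.+1 -> homogeneous (m - j.+1%:Z - delta k) (g F)) /\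
    (forall F, #|F| = j -> koszul lin g F = f F 0 k).
  move=> k; have sub i : m - i - delta k = m - delta k - i by ring.
  have [||F Fj|g [hg dg]] := linform_koszul_exact BC CB (e := m - delta k) (j := j)
                       (f := fun F => f F 0 k : S^o).
  - by rewrite subr_eq0 eq_sym.
  - by move=> F Fj; rewrite -sub; apply: hf.
  - by rewrite -entry df // mxE.
  - by exists g; split=> F Fj; rewrite ?sub; [apply: hg | apply: dg].
exists (fun F => \row_k g k F); split=> F Fj.
  by move=> k; rewrite mxE; apply: (hg k).1.
apply/rowP => k; rewrite entry -(hg k).2 //.
by rewrite /koszul; apply: eq_bigr => t tF; rewrite mxE.
Qed.

Variables (X : Type) (G : int -> (X -> K) -> Prop) (sigma : 'I_N -> X -> K).
Variables (E : minimal_resolution G sigma) (p : nat).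
Notation degs i := (@shift _ _ _ _ _ E i).
Notation gens := (@aug _ _ _ _ _ E).
(* The degree p+2 is the total degree of Lambda^p H^0(L) (x) H^0(L^2). *)
Hypothesis shiftE : forall i, (i <= p)%N -> forall k : 'I_(rk E i), shift k != p.+2%:Z.

Definition syzygy i : 'rV[S]_(rk E i) -> Prop :=
  if i is i'.+1 then fun v => v *m diff E i' = 0
  else fun v => augment sigma gens v =1 (fun=> 0).

Lemma syzygyP i m (v : 'rV[S]_(rk E i)) : in_degree (degs i) m v ->
  syzygy v <-> exists2 w, in_degree (degs i.+1) m w & v = w *m diff E i.
Proof. by case: i v => [|i] v hv; [apply: exact_at_0 | apply: exact_at_S]. Qed.

Lemma in_degree_diff i m (v : 'rV[S]_(rk E i.+1)) :
  in_degree (degs i.+1) m v ->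
  in_degree (degs i) m (v *m diff E i).
Proof. by apply: in_degree_mulmx; apply: diff_graded. Qed.

Lemma koszul_mulmx b b' (A : 'M[S]_(b, b')) (f : {set 'I_N} -> 'rV[S]_b) F :
  koszul lin f F *m A = koszul lin (fun F' => f F' *m A) F.
Proof.
apply: (koszul_semilinear (rho := idfun) (phi := fun v => v *m A)) => c v w.
by rewrite mulmxDl scalemxAl.
Qed.

(** Let Z_i be the kernel of E_i -> E_(i-1).  In the long exact sequence of Koszul
    homology of 0 -> Z_(i+1) -> E_(i+1) -> Z_i -> 0 the middle term vanishes, and
    a cycle of Z_i on [j]-element sets becomes a cycle of Z_(i+1) on sets with one
    element less.  At j = 0 a lift to E_(i+1) is a cycle for lack of smaller
    sets.  As i + j = p - 1, only E_1, ..., E_p are met on the way. *)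
Lemma syzygy_koszul_exact j : forall i (u : {set 'I_N} -> 'rV[S]_(rk E i)),
    (i + j.+1 = p)%N ->
    (forall F, #|F| = j ->
       in_degree (degs i) (p.+2%:Z - j%:Z) (u F) /\ syzygy (u F)) ->
    (forall F, #|F|.+1 = j -> koszul lin u F = 0) ->
  exists v : {set 'I_N} -> 'rV[S]_(rk E i),
    (forall F, #|F| = j.+1 ->
       in_degree (degs i) (p.+2%:Z - j.+1%:Z) (v F) /\ syzygy (v F)) /\
    (forall F, #|F| = j -> koszul lin v F = u F).
Proof.
elim: j => [|j IHj] i u ijp hu du.
- have /fin_all_exists [y hy] : forall F, exists y : 'rV[S]_(rk E i.+1), #|F| = 0%N ->
      in_degree (degs i.+1) (p.+2%:Z - 0%N%:Z) y /\ u F = y *m diff E i.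
    move=> F; case: (eqVneq #|F| 0%N) => [F0|/eqP nF]; last by exists 0.
    by have [hF /(syzygyP hF)[y y1 y2]] := hu F F0; exists y.
  have [|F F0|F //|v [hv dv]] := free_koszul_exact (f := y) (j := 0) (m := p.+2%:Z)
       (delta := degs i.+1).
  + by move=> k; apply: shiftE; rewrite -ijp addn1.
  + exact: (hy F F0).1.
  exists (fun F => v F *m diff E i); split=> F F0.
    have hvF := in_degree_diff (hv F F0); split=> //.
    by apply/(syzygyP hvF); exists (v F) => //; apply: hv.
  by rewrite -koszul_mulmx dv // -(hy F F0).2.
have /fin_all_exists [y hy] : forall F, exists y : 'rV[S]_(rk E i.+1), #|F| = j.+1 ->
    in_degree (degs i.+1) (p.+2%:Z - j.+1%:Z) y /\ u F = y *m diff E i.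
  move=> F; case: (eqVneq #|F| j.+1) => [Fj|/eqP nF]; last by exists 0.
  by have [hF /(syzygyP hF)[y y1 y2]] := hu F Fj; exists y.
have cardU F t : t \notin F -> #|t |: F| = #|F|.+1 by move=> tF; rewrite cardsU1 tF.
have [||F Fj|v [hv dv]] := IHj i.+1 (koszul lin y); first by rewrite -ijp addSnnS.
- move=> F Fj; split; last first.
    rewrite /= koszul_mulmx; apply: etrans (du F _); last by rewrite Fj.
    by apply: eq_koszul => t tF; rewrite -(hy _ _).2 // cardU // Fj.
  apply: in_degree_koszul => t tF.
  have -> : p.+2%:Z - j%:Z - 1 = p.+2%:Z - j.+1%:Z by lia.
  by apply: (hy _ _).1; rewrite cardU // Fj.
- exact: koszulK.
have [||F Fj|g [hg dg]] := free_koszul_exact (f := fun F => y F - v F) (j := j.+1)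
       (m := p.+2%:Z) (delta := degs i.+1).
- by move=> k; apply: shiftE; rewrite -ijp -addSnnS leq_addr.
- by move=> F Fj; apply: in_degreeB; [apply: (hy F Fj).1 | apply: (hv F Fj).1].
- by rewrite koszulB dv ?subrr //; apply: succn_inj.
exists (fun F => g F *m diff E i); split=> F Fj.
  have hgF := in_degree_diff (hg F Fj); split=> //.
  by apply/(syzygyP hgF); exists (g F) => //; apply: hg.
have vF : v F *m diff E i = 0 := (hv F Fj).2.
by rewrite -koszul_mulmx dg // mulmxBl vF subr0 -(hy F Fj).2.
Qed.

Hypothesis rkE0 : rk E 0 = 1%N.
Hypothesis shiftE0 : forall k : 'I_(rk E 0), shift k = 0.
Hypothesis G1 : G 0 (fun=> 1).

Lemma augment_semilinear x c (v w : 'rV[S]_(rk E 0)) :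
  augment sigma gens (c *: v + w) x =
  c.@[sigma^~ x] * augment sigma gens v x + augment sigma gens w x.
Proof.
rewrite /augment mulr_sumr -big_split; apply: eq_bigr => k _ /=.
by rewrite !mxE mevalD mevalM mulrDl mulrA.
Qed.

Notation tau := (new_basis B sigma).

Lemma meval_linform t x : (lin t).@[sigma^~ x] = tau t x.
Proof.
rewrite /linform raddf_sum; apply: eq_bigr => j _ /=.
by rewrite mevalZ mevalXU.
Qed.

(** The section 1 of degree 0 is a constant multiple of the generator of E_0,
    which is therefore a constant function with value [c]. *)
Lemma augment_linear_form :
  exists c, forall v : 'rV[S]_(rk E 0), in_degree (degs 0) 1 v ->
    exists w : 'I_N -> K, forall x,
      augment sigma gens v x = \sum_u c * w u * tau u x.
Proof.
have k0 : 'I_(rk E 0) by rewrite rkE0; exact: ord0.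
have onek (k : 'I_(rk E 0)) : k = k0.
  by apply/val_inj => /=; move: (ltn_ord k) (ltn_ord k0) rkE0; lia.
have augk v x : augment sigma gens v x = (v 0 k0).@[sigma^~ x] * gens k0 x.
  by rewrite /augment (bigD1 k0) //= big1 ?addr0 // => k; rewrite (onek k) eqxx.
have [v hv v1] := aug_surjective E G1.
have vC := homogeneous_const (hv k0); rewrite shiftE0 in vC.
have {v1} aug1 x : (v 0 k0)@_0%MM * gens k0 x = 1.
  by have /= := v1 x; rewrite augk {1}vC ?subr0 // mevalC => <-.
exists ((v 0 k0)@_0%MM)^-1 => w hw; exists (fun u => (linderiv C u (w 0 k0))@_0%MM) => x.
have := hw k0; rewrite shiftE0 subr0 => /(linear_linform CB) wE.
have c0 : (v 0 k0)@_0%MM != 0.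
  by apply: contra_eq_neq (aug1 x) => ->; rewrite mul0r eq_sym oner_neq0.
rewrite augk (_ : gens k0 x = ((v 0 k0)@_0%MM)^-1); last first.
  by apply: (mulfI c0); rewrite aug1 divff.
rewrite {1}wE raddf_sum mulr_suml; apply: eq_bigr => u _ /=.
by rewrite mevalZ meval_linform mulrAC [_ * _^-1]mulrC.
Qed.

(** K_(p,2) = 0.  As the primitive has coefficients in H^0(L), it is given by
    its coordinates [w F u] in the basis [tau]. *)
Lemma koszul_vanishing (z : {set 'I_N} -> X -> K) :
    (forall F, #|F| = p -> G 2 (z F)) ->
    (forall F x, #|F|.+1 = p -> koszul (tau^~ x) (fun F' => z F' x : K^o) F = 0) ->
  exists w : {set 'I_N} -> 'I_N -> K, forall F x, #|F| = p ->
    koszul (tau^~ x) (fun F' => \sum_u w F' u * tau u x : K^o) F = z F x.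
Proof.
move=> hz dz.
have cardU F t : t \notin F -> #|t |: F| = #|F|.+1 by move=> tF; rewrite cardsU1 tF.
have aug_koszul (y : {set 'I_N} -> 'rV[S]_(rk E 0)) F x :
   augment sigma gens (koszul lin y F) x =
   koszul (tau^~ x) (fun F' => augment sigma gens (y F') x : K^o) F.
  rewrite (koszul_semilinear (rho := meval (sigma^~ x)) (M' := K^o)
     (phi := fun v => augment sigma gens v x)); last exact: augment_semilinear.
  by apply: eq_bigr => t _; rewrite /= meval_linform.
have /fin_all_exists [y hy] : forall F, exists y : 'rV[S]_(rk E 0), #|F| = p ->
    in_degree (degs 0) 2 y /\ z F =1 augment sigma gens y.
  move=> F; case: (eqVneq #|F| p) => [Fj|/eqP nF]; last by exists 0.
  by have [y y1 y2] := aug_surjective E (hz F Fj); exists y.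
have p2 : p.+2%:Z - p%:Z = 2 by lia.
have [v hv dv] : exists2 v : {set 'I_N} -> 'rV[S]_(rk E 0),
    (forall F, #|F| = p -> in_degree (degs 0) 2 (v F) /\ syzygy (v F)) &
    (forall F, #|F|.+1 = p -> koszul lin v F = koszul lin y F).
  case Ep : p => [|p'].
    exists (fun=> 0) => F F0; last by discriminate F0.
    split; first exact: in_degree0.
    by move=> x; rewrite /augment big1 // => k _; rewrite mxE meval0 mul0r.
  have [||F Fj|v [hv dv]] := @syzygy_koszul_exact p' 0 (koszul lin y).
  - by rewrite Ep.
  - move=> F Fj; split=> [|x].
      apply: in_degree_koszul => t tF.
      have -> : p.+2%:Z - p'%:Z - 1 = 2 by lia.
      by apply: (hy _ _).1; rewrite cardU // Fj Ep.
    rewrite aug_koszul; apply: etrans (dz F x _); last by rewrite Fj Ep.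
    by apply: eq_bigr => t tF; rewrite -(hy _ _).2 // cardU // Fj Ep.
  - exact: koszulK.
  exists v => F Fj; last by apply: dv; apply: succn_inj.
  by rewrite -p2 Ep; rewrite Ep in hv; apply: hv.
have [||F Fj|g [hg dg]] := free_koszul_exact (f := fun F => y F - v F) (j := p)
       (m := p.+2%:Z) (delta := degs 0).
- by move=> k; apply: shiftE.
- by move=> F Fj; rewrite p2; apply: in_degreeB; [apply: (hy F Fj).1 | apply: (hv F Fj).1].
- by rewrite koszulB dv ?subrr.
have [c hc] := augment_linear_form.
have /fin_all_exists [w hw] : forall F, exists w : 'I_N -> K, #|F| = p.+1 ->
    forall x, augment sigma gens (g F) x = \sum_u c * w u * tau u x.
  move=> F; case: (eqVneq #|F| p.+1) => [Fj|/eqP nF]; last by exists (fun=> 0).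
  have := hg F Fj; have -> : p.+2%:Z - p.+1%:Z = 1 by lia.
  by move=> /hc [w hw]; exists w.
exists (fun F u => c * w F u) => F x Fp.
rewrite (hy F Fp).2.
have vF : augment sigma gens (v F) x = 0 := (hv F Fp).2 x.
have -> : y F = 1 *: koszul lin g F + v F by rewrite dg // scale1r subrK.
rewrite augment_semilinear vF addr0 meval1 mul1r aug_koszul.
by apply: eq_bigr => t tF; rewrite hw // cardU // Fp.
Qed.

End Vanishing.

(** * Restricting sections to lines *)

Section Univariate.
Variable K : numClosedFieldType.
Implicit Types P Q : {poly K}.

Lemma horner_eq0 P : (forall t, P.[t] = 0) -> P = 0.
Proof.
move=> P0; apply: (@roots_geq_poly_eq0 _ _ [seq i%:R | i <- iota 0 (size P)]).
- by apply/allP => t _; rewrite rootE P0.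
- by rewrite map_inj_uniq ?iota_uniq // => i j /eqP; rewrite eqr_nat => /eqP.
- by rewrite size_map size_iota.
Qed.

Lemma horner_inj P Q : (forall t, P.[t] = Q.[t]) -> P = Q.
Proof.
move=> PQ; apply/eqP; rewrite -subr_eq0; apply/eqP/horner_eq0 => t.
by rewrite !hornerE PQ subrr.
Qed.

Lemma horner_inj_away P Q R : R != 0 ->
  (forall t, R.[t] != 0 -> P.[t] = Q.[t]) -> P = Q.
Proof.
move=> R0 PQ; apply: (mulIf R0); apply: horner_inj => t; rewrite !hornerM.
by have [->|/PQ ->] := eqVneq R.[t] 0; rewrite ?mulr0.
Qed.

(** If the denominator of a fraction for [f] has a root [c], a fraction whose
    denominator does not vanish at [c] shows that the numerator vanishes there
    too, so that [X - c] cancels. *)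
Lemma local_fraction_poly (f : K -> K) :
    (forall t0, exists P Q, Q.[t0] != 0 /\
       forall t, Q.[t] != 0 -> f t = P.[t] / Q.[t]) ->
  exists P, forall t, f t = P.[t].
Proof.
move=> floc.
suff red : forall k P Q, (size Q <= k)%N -> Q != 0 ->
    (forall t, Q.[t] != 0 -> f t = P.[t] / Q.[t]) -> exists P', forall t, f t = P'.[t].
  have [P [Q [Q0 fPQ]]] := floc 0; apply: (red (size Q) P Q) => //.
  by apply: contraNneq Q0 => ->; rewrite horner0.
elim=> [|k IHk] P Q szQ Q0 fPQ.
  by rewrite leqn0 size_poly_eq0 (negbTE Q0) in szQ.
have [sz1|sz1] := eqVneq (size Q) 1%N.
  have /eqP/size_poly1P [c c0 Qc] := sz1.
  exists (c^-1 *: P) => t; rewrite hornerZ mulrC fPQ Qc ?hornerC //.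
have /closed_rootP [c cQ] := sz1.
have [P' [Q' [Q'c fPQ']]] := floc c.
have Q'0 : Q' != 0 by apply: contraNneq Q'c => ->; rewrite horner0.
have cross : P * Q' = P' * Q.
  apply: (@horner_inj_away _ _ (Q * Q')); first by rewrite mulf_neq0.
  move=> t; rewrite !hornerM mulf_eq0 negb_or => /andP[Qt Q't].
  have := fPQ t Qt; rewrite fPQ' // => /eqP; rewrite eqr_div // => /eqP ->.
  by rewrite mulrC.
have cP : root P c.
  have := congr1 (horner^~ c) cross; rewrite /= !hornerM (rootP cQ) mulr0.
  by move=> /eqP; rewrite mulf_eq0 (negbTE Q'c) orbF.
move: cP cQ => /factor_theorem [P1 EP] /factor_theorem [Q1 EQ].
have Q10 : Q1 != 0 by apply: contraNneq Q0 => E; rewrite EQ E mul0r.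
have X0 : 'X - c%:P != 0 by rewrite polyXsubC_eq0.
apply: (IHk P1 Q1) => //.
  by move: szQ; rewrite EQ size_Mmonic ?monicXsubC // size_XsubC addn2.
move=> t; have [->|tc] := eqVneq t c => Q1t.
  rewrite fPQ' //; apply/eqP; rewrite eqr_div // -!hornerM; apply/eqP.
  by congr (_.[_]); apply: (mulIf X0); rewrite -mulrA -EQ -cross EP mulrAC.
have tcX : ('X - c%:P).[t] != 0 by rewrite hornerXsubC subr_eq0.
rewrite fPQ; last by rewrite EQ hornerM mulf_neq0.
by rewrite EP EQ !hornerM -mulf_div divff // mulr1.
Qed.

(** The function that [P] and [Q] describe in the two charts of P^1 is a binary
    form of degree [k]; its coefficient at t^k is its value at infinity. *)
Lemma poly_of_two_charts P Q k :
    (forall t, t != 0 -> P.[t] = t ^+ k * Q.[t^-1]) ->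
  (size P <= k.+1)%N /\ P`_k = Q.[0].
Proof.
move=> PQ; pose s := size Q; pose R := \poly_(i < s.+1) Q`_(s - i).
have RQ t : t != 0 -> R.[t] = t ^+ s * Q.[t^-1].
  move=> t0; rewrite horner_poly (@horner_coef_wide _ s.+1) // mulr_sumr.
  rewrite [RHS](reindex_inj rev_ord_inj) /=; apply: eq_bigr => i _.
  rewrite subSS mulrCA exprVn -exprB ?leq_subr ?unitfE //.
  by rewrite subKn // -ltnS.
have PR : 'X^s * P = 'X^k * R.
  apply: (@horner_inj_away _ _ 'X) => [|t]; first by rewrite polyX_eq0.
  rewrite hornerX => t0; rewrite !hornerM !hornerXn PQ // RQ //.
  by rewrite mulrCA.
have coefP i : (k <= s + i)%N -> P`_i = R`_(s + i - k).
  have := congr1 (fun p : {poly K} => p`_(s + i)) PR.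
  by rewrite /= !coefXnM addKn !ltnNge leq_addr /= => ->; case: leqP.
split; last first.
  by rewrite coefP ?leq_addl // addnK coef_poly ltnSn subnn horner_coef0.
apply/leq_sizeP => i ki; rewrite coefP ?coef_poly; last first.
  by rewrite (leq_trans _ (leq_addl _ _)) // ltnW.
by case: ltnP => //; lia.
Qed.

End Univariate.

Section Sections.
Variables (K : numClosedFieldType) (d : nat) (n a : 'I_d -> nat).
Hypothesis n_gt0 : forall i, (0 < n i)%N.
Implicit Types (x : hcoord K n) (e : 'I_d -> nat) (r : 'I_d).

(** The point t of P^1 in the chart around 0, if the Boolean is false, or around
    infinity otherwise. *)
Definition p1coords (c : bool * K) : seq K := if c.1 then [:: c.2; 1] else [:: 1; c.2].

Fact p1point_subproof (u : 'I_d -> bool * K) :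
  [forall i, (\row_(j < (n i).+1) (p1coords (u i))`_j : 'rV[K]_(n i).+1) != 0].
Proof.
apply/forallP => i; apply/eqP => /rowP E.
have := E (inord (u i).1); rewrite !mxE inordK; last first.
  by rewrite ltnS (leq_trans _ (n_gt0 i)) // leq_b1.
by rewrite /p1coords; case: (u i).1 => /= /eqP; rewrite oner_eq0.
Qed.

(** A point of the product of copies of P^1, each of which is the line through
    the first two coordinate points of a factor. *)
Definition p1point (u : 'I_d -> bool * K) : hcoord K n :=
  exist _ (fun i => \row_j (p1coords (u i))`_j) (p1point_subproof u).

Definition upd (u : 'I_d -> bool * K) r c : 'I_d -> bool * K :=
  fun i => if i == r then c else u i.

Lemma regular_on_line (s : hcoord K n -> K) u r b : regular s ->
  exists P : {poly K}, forall t, s (p1point (upd u r (b, t))) = P.[t].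
Proof.
move=> sreg.
pose h (v : 'I_(nvars n)) : {poly K} := let i := tag (enum_val v) in
  if i == r then (if b then [:: 'X; 1] else [:: 1; 'X])`_(tagged (enum_val v))
  else ((p1coords (u i))`_(tagged (enum_val v)))%:P.
have hE q t : (mmap polyC h q).[t] = q.@[coords (p1point (upd u r (b, t)))].
  rewrite mevalE /mmap horner_sum; apply: eq_bigr => m _.
  rewrite hornerM hornerC; congr (_ * _); rewrite /mmap1 horner_prod.
  apply: eq_bigr => v _; rewrite horner_exp; congr (_ ^+ _).
  rewrite /h /coords /= mxE /upd; case: eqP => _; last by rewrite hornerC.
  by rewrite /p1coords; case: (b) => /=; case: (nat_of_ord _) => [|[|j]];
     rewrite /= ?hornerX ?hornerC ?nth_nil ?horner0.
apply: local_fraction_poly => t0.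
have [p [q [q0 spq]]] := sreg (p1point (upd u r (b, t0))).
exists (mmap polyC h p), (mmap polyC h q); rewrite hE; split=> // t.
by rewrite !hE; apply: spq.
Qed.

Lemma equivariant_eq a' (s : hcoord K n -> K) x y : equivariant a' s ->
  (forall i, sval x i = sval y i) -> s x = s y.
Proof.
move=> seq xy; rewrite (seq (fun=> 1) y x) => [|i|i]; rewrite ?oner_neq0 //.
  by rewrite big1 ?mul1r // => i _; rewrite exp1rz.
by rewrite scale1r xy.
Qed.

Lemma eq_p1point a' (s : hcoord K n -> K) u v : equivariant a' s ->
  u =1 v -> s (p1point u) = s (p1point v).
Proof. by move=> seq uv; apply: (equivariant_eq seq) => i /=; rewrite uv. Qed.

(** Equivariance under the r-th scalar compares the two charts of the line; it is
    the only place where the degree [a r] enters. *)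
Lemma section_on_line (s : hcoord K n -> K) u r : section_ring a 1 s ->
  exists P : {poly K}, [/\ (size P <= (a r).+1)%N,
    forall t, s (p1point (upd u r (false, t))) = P.[t] &
    P`_(a r) = s (p1point (upd u r (true, 0)))].
Proof.
move=> [sreg seq].
have [P sP] := regular_on_line u r false sreg.
have [Q sQ] := regular_on_line u r true sreg.
have [t t0|szP Pa] := @poly_of_two_charts K P Q (a r); last first.
  by exists P; split=> //; rewrite Pa sQ.
rewrite -sP -sQ (seq (fun i => if i == r then t else 1)
    (p1point (upd u r (true, t^-1)))) => [|i|i].
- congr (_ * _); rewrite (bigD1 r) //= eqxx mul1r -exprnP big1 ?mulr1 // => i ir.
  by rewrite (negbTE ir) exp1rz.
- by case: ifP => _ //; exact: oner_neq0.
- apply/rowP => j; rewrite !mxE /upd; case: eqP => _; last by rewrite mul1r.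
  rewrite /p1coords /=; case: (nat_of_ord j) => [|[|k]] /=.
  + by rewrite divff.
  + by rewrite mulr1.
  + by rewrite !nth_nil mulr0.
Qed.

(** The monomial of multidegree [m * a] whose exponents at the second coordinates
    are [e]. *)
Definition mono m e x : K :=
  \prod_i (sval x i 0 (inord 0) ^+ (m * a i - e i) * sval x i 0 (inord 1) ^+ e i).

Lemma section_mono m e : (forall i, e i <= m * a i)%N -> section_ring a m%:Z (mono m e).
Proof.
move=> ema; split=> [x|lam x y lam0 yx].
  pose var i j : 'I_(nvars n) := enum_rank (Tagged (fun i => 'I_(n i).+1) (j : 'I_(n i).+1)).
  have varE i j y : coords y (var i j) = sval y i 0 j.
    by rewrite /coords /var enum_rankK.
  exists (\prod_i ('X_(var i (inord 0)) ^+ (m * a i - e i) * 'X_(var i (inord 1)) ^+ e i)), 1.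
  split=> [|y _]; rewrite meval1 ?oner_neq0 // divr1 rmorph_prod.
  by apply: eq_bigr => i _; rewrite rmorphM !rmorphXn /= !mevalXU !varE.
rewrite /mono -big_split; apply: eq_bigr => i _ /=; rewrite yx !mxE !exprMn.
rewrite -PoszM -exprnP -{3}(subnK (ema i)) exprD; ring.
Qed.

Lemma eq_section m (s s' : hcoord K n -> K) : s =1 s' ->
  section_ring a m s -> section_ring a m s'.
Proof.
move=> ss' [sreg seq]; split=> [x|lam x y lam0 yx]; last by rewrite -!ss' (seq lam x y).
have [p [q [q0 spq]]] := sreg x; exists p, q; split=> // y.
by rewrite -ss'; apply: spq.
Qed.

Lemma sectionZ m c (s : hcoord K n -> K) : section_ring a m s ->
  section_ring a m (fun x => c * s x).
Proof.
move=> [sreg seq]; split=> [x|lam x y lam0 yx].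
  have [p [q [q0 spq]]] := sreg x; exists (c *: p), q; split=> // y qy.
  by rewrite mevalZ spq // mulrA.
by rewrite (seq lam x y) // mulrCA.
Qed.

Lemma monoM m1 m2 e1 e2 x : (forall i, e1 i <= m1 * a i)%N ->
  (forall i, e2 i <= m2 * a i)%N ->
  mono m1 e1 x * mono m2 e2 x = mono (m1 + m2) (fun i => (e1 i + e2 i)%N) x.
Proof.
move=> le1 le2; rewrite -big_split; apply: eq_bigr => i _ /=.
have -> : ((m1 + m2) * a i - (e1 i + e2 i) = (m1 * a i - e1 i) + (m2 * a i - e2 i))%N.
  by move: (le1 i) (le2 i); nia.
by rewrite !exprD; ring.
Qed.

Lemma eq_mono m e1 e2 x : e1 =1 e2 -> mono m e1 x = mono m e2 x.
Proof. by move=> e12; apply: eq_bigr => i _; rewrite e12. Qed.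

Lemma mono0 x : mono 0 (fun=> 0%N) x = 1.
Proof. by rewrite /mono big1 // => i _; rewrite mul0n !expr0 mulr1. Qed.

Lemma mono_p1point m e u : mono m e (p1point u) =
  \prod_i (u i).2 ^+ (if (u i).1 then m * a i - e i else e i)%N.
Proof.
apply: eq_bigr => i _; rewrite !mxE !inordK ?ltnS ?n_gt0 // /p1coords.
by case: (u i).1 => /=; rewrite ?expr1n ?mul1r ?mulr1.
Qed.

End Sections.

(** * Bases of sections adapted to a cycle *)

(** Since [A *m R *m A = A], the space splits into the rows of [R] and the kernel
    of [A]; the vector [v] is completed to a basis of that kernel. *)
Lemma adapted_basis (K : fieldType) (N D : nat) (A : 'M[K]_(N, D))
    (R : 'M[K]_(D, N)) (v : 'rV[K]_N) :
    R *m A = 1%:M -> v *m A = 0 -> v != 0 ->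
  (D < N)%N /\ exists B : 'M[K]_N, [/\ B \in unitmx,
    forall (t : 'I_N) (i : 'I_D), t = i :> nat -> row t B = row i R,
    forall t : 'I_N, t = D :> nat -> row t B = v &
    forall t : 'I_N, (D <= t)%N -> row t B *m A = 0].
Proof.
move=> RA vA v0.
pose Rs := [tuple row i R | i < D].
pose ker := lker (linfun (mulmxr A : 'rV[K]_N -> 'rV[K]_D)).
have kerE y : (y \in ker) = (y *m A == 0) by rewrite memv_ker lfunE.
have RsE (k : 'I_D -> K) : \sum_i k i *: Rs`_i = (\row_i k i) *m R.
  rewrite mulmx_sum_row; apply: eq_bigr => i _.
  by rewrite mxE -tnth_nth tnth_mktuple.
have freeR : free Rs.
  apply/freeP => k; rewrite RsE => /(congr1 (mulmx^~ A)) /=.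
  by rewrite -mulmxA RA mulmx1 mul0mx => /rowP E i; have := E i; rewrite !mxE.
have capR : (<<Rs>> :&: ker = 0)%VS.
  apply/eqP; rewrite -subv0; apply/subvP => y; rewrite memv_cap kerE memv0.
  move=> /andP[/coord_span -> /eqP]; rewrite RsE -mulmxA RA mulmx1 => ->.
  by rewrite mul0mx.
have addR : (<<Rs>> + ker = fullv)%VS.
  apply/eqP; rewrite eqEsubv subvf; apply/subvP => y _.
  rewrite -(subrK (y *m A *m R) y) addrC memv_add //.
    rewrite (_ : _ *m R = \sum_i (y *m A) 0 i *: Rs`_i); last first.
      by rewrite RsE; congr (_ *m _); apply/rowP => i; rewrite [RHS]mxE.
    apply: memv_suml => i _; apply/memvZ/memv_span.
    by rewrite -tnth_nth mem_tnth.
  by rewrite kerE mulmxBl -[_ *m R *m A]mulmxA RA mulmx1 subrr.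
have vker : v \in ker by rewrite kerE vA.
pose Y : seq 'rV[K]_N := vbasis (ker :\: <[v]>)%VS.
have basY : basis_of ker (v :: Y).
  have kerD : ker = (<[v]> + (ker :\: <[v]>))%VS.
    rewrite -[LHS](addv_diff_cap ker <[v]>) addvC; congr (_ + _)%VS.
    by apply/capv_idPr; rewrite -memvE.
  rewrite kerD -cat1s; apply: cat_basis; last exact: vbasisP.
    by apply/directv_addP; rewrite capvC capv_diff.
  by rewrite seq1_basis.
have basX : basis_of fullv (Rs ++ v :: Y).
  rewrite -addR; apply: cat_basis => //; first exact/directv_addP.
  by rewrite basisEfree freeR subvv (eqP freeR) leqnn.
pose X := Rs ++ v :: Y.
have sizeX : size X = N.
  have := @vector.size_basis _ _ fullv _ (in_tuple X) basX.
  by rewrite dimvf dim_matrix => <-; apply: mul1n.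
have DN : (D < N)%N by rewrite -sizeX size_cat size_tuple /= addnS ltnS leq_addr.
split=> //; pose B := \matrix_(t < N) (X`_t); exists B.
have rowB t : row t B = X`_t by rewrite rowK.
split.
- rewrite -row_free_unit; apply: inj_row_free => k kB.
  have /freeP freeX : free (tcast sizeX (in_tuple X)).
    by rewrite val_tcast; apply: basis_free basX.
  apply/rowP => t; rewrite mxE; apply: (freeX (k 0)).
  rewrite -[RHS]kB mulmx_sum_row; apply: eq_bigr => t' _.
  by rewrite rowB val_tcast.
- move=> t i ti; rewrite rowB /X nth_cat size_tuple ti ltn_ord.
  by rewrite -tnth_nth tnth_mktuple.
- by move=> t tD; rewrite rowB /X nth_cat size_tuple tD ltnn subnn.
- move=> t Dt; rewrite rowB /X nth_cat size_tuple ltnNge Dt /=.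
  apply/eqP; rewrite -kerE; apply: (basis_mem basY); apply: mem_nth.
  rewrite -(ltn_add2l D) subnKC //; apply: leq_trans (ltn_ord t) _.
  by rewrite -{1}sizeX size_cat size_tuple.
Qed.

(** The lattice points [w 0, ..., w D.-1] lie on a closed polygon made of edges of
    the box of all exponents between 0 and [a]: the edge joining [w i] to its
    successor has the direction [dir i], and every lattice point of that edge
    occurs in the cycle. *)
Record lattice_cycle (d : nat) (a : 'I_d -> nat) (D : nat)
    (w : nat -> 'I_d -> nat) (dir : nat -> 'I_d) : Prop := LatticeCycle {
  cycle_le : forall i r, (i < D)%N -> (w i r <= a r)%N;
  cycle_inj : forall i j, (i < D)%N -> (j < D)%N -> w i =1 w j -> i = j;
  cycle_edge : forall i r, (i < D)%N -> r != dir i -> w (i.+1 %% D)%N r = w i r;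
  cycle_face : forall i r, (i < D)%N -> r != dir i -> w i r = 0%N \/ w i r = a r;
  cycle_full : forall i k, (i < D)%N -> (k <= a (dir i))%N ->
    exists2 j, (j < D)%N & w j (dir i) = k /\ (forall r, r != dir i -> w j r = w i r)
}.

Section Curves.
Variables (K : numClosedFieldType) (d : nat) (n a : 'I_d -> nat).
Hypothesis n_gt0 : forall i, (0 < n i)%N.
Variables (D : nat) (w : nat -> 'I_d -> nat) (dir : nat -> 'I_d).
Hypothesis cyc : lattice_cycle a D w dir.
Implicit Types (e : 'I_d -> nat) (i j u : nat) (r : 'I_d) (t : K).

Definition corner i r : bool * K := (w i r != 0%N, 0).

(** The line in the product that corresponds to the edge of [w i]. *)
Definition curve i t : hcoord K n :=
  p1point n_gt0 (upd (corner i) (dir i) (false, t)).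

Definition on_face i e := [forall r, (r == dir i) || (e r == w i r)].

(** The restriction of the monomial with exponents [e] to this line: it vanishes
    unless [e] is on the edge. *)
Definition trace i e : {poly K} := if on_face i e then 'X^(e (dir i)) else 0.

Lemma mono_curve i e t : (i < D)%N -> (forall r, e r <= a r)%N ->
  mono a 1 e (curve i t) = (trace i e).[t].
Proof.
move=> iD ea; rewrite mono_p1point /trace /on_face.
case: forallP => [face|nface].
  rewrite hornerXn (bigD1 (dir i)) //= /upd eqxx /= big1 ?mulr1 // => r rd.
  have := face r; rewrite (negbTE rd) /= => /eqP E; rewrite /corner E /=.
  case: eqP => [->|w0]; first by rewrite /= expr0.
  by have [] := cycle_face cyc iD rd => // ->; rewrite mul1n subnn expr0.
rewrite horner0; apply/eqP; rewrite prodf_seq_eq0; apply/hasP.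
have : [exists r, ~~ ((r == dir i) || (e r == w i r))].
  by rewrite -negb_forall; apply/negP => /forallP.
case/existsP => r; rewrite negb_or => /andP[rd er]; exists r; rewrite ?mem_index_enum //=.
rewrite /upd (negbTE rd) /corner /= expf_eq0 eqxx andbT.
have := cycle_face cyc iD rd; have := ea r; move: er.
case: (eqVneq (w i r) 0%N) => [->|w0] /=; first by rewrite lt0n.
move=> er ear [/eqP|ar]; first by rewrite (negbTE w0).
by rewrite mul1n subn_gt0 ltn_neqAle ear -ar er.
Qed.

Lemma trace_cycle_coef i j u : (i < D)%N -> (j < D)%N -> (u < D)%N -> on_face i (w j) ->
  (trace i (w u))`_(w j (dir i)) = (u == j)%:R.
Proof.
move=> iD jD uD fj; rewrite /trace; case: ifP => fu; last first.
  by rewrite coef0; case: eqP => // uj; rewrite uj fj in fu.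
rewrite coefXn; congr (_%:R); congr nat_of_bool; apply/eqP/eqP => [E|-> //].
apply: (cycle_inj cyc) => // r; case: (eqVneq r (dir i)) => [->//|rd].
have := forallP fj r; have := forallP fu r; rewrite (negbTE rd) /=.
by move=> /eqP -> /eqP ->.
Qed.

Lemma on_face_self i : on_face i (w i).
Proof. by apply/forallP => r; rewrite eqxx orbT. Qed.

Lemma on_face_next i : (i < D)%N -> on_face i (w (i.+1 %% D)%N).
Proof.
move=> iD; apply/forallP => r; case: eqVneq => //= rd.
by rewrite (cycle_edge cyc).
Qed.

Lemma trace_off_cycle i e : (i < D)%N -> (forall r, e r <= a r)%N ->
  (forall j, (j < D)%N -> ~ e =1 w j) -> trace i e = 0.
Proof.
move=> iD ea ew; rewrite /trace; case: ifP => // fe.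
have [j jD [jd jr]] := cycle_full cyc iD (ea (dir i)).
case: (ew j jD) => r; case: (eqVneq r (dir i)) => [->//|rd].
by have := forallP fe r; rewrite (negbTE rd) jr //= => /eqP.
Qed.

(** The extreme coefficients are the values of the section at the ends of the
    edge, so two edges that meet at a corner have the same coefficient there. *)
Lemma corner_coef (s : hcoord K n -> K) i k (P : {poly K}) :
    (forall t, s (curve i t) = P.[t]) ->
    P`_(a (dir i)) = s (p1point n_gt0 (upd (corner i) (dir i) (true, 0))) ->
    k = 0%N \/ k = a (dir i) ->
  P`_k = s (p1point n_gt0 (upd (corner i) (dir i) (k != 0%N, 0))).
Proof.
move=> sP Pa; case: (posnP k) => [-> _|k0 []E]; rewrite /=.
- by rewrite -horner_coef0 -sP.
- by rewrite E in k0.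
- by rewrite E.
Qed.

(** The restrictions of a section to the different edges are given by one and the
    same coefficient for each lattice point of the cycle. *)
Lemma section_on_cycle (s : hcoord K n -> K) : section_ring a 1 s ->
  exists b : 'I_D -> K, forall i t, (i < D)%N ->
    s (curve i t) = (\sum_u b u *: trace i (w u)).[t].
Proof.
move=> sG; have seq := sG.2.
have /fin_all_exists [P hP] : forall i : 'I_D, exists P : {poly K},
    [/\ (size P <= (a (dir i)).+1)%N, forall t, s (curve i t) = P.[t] &
     P`_(a (dir i)) = s (p1point n_gt0 (upd (corner i) (dir i) (true, 0)))].
  by move=> i; apply: section_on_line.
exists (fun i : 'I_D => (P i)`_(w i (dir i))) => i0 t iD; pose i := Ordinal iD.
rewrite -[i0]/(nat_of_ord i); have [szP sP Pa] := hP i.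
rewrite sP; congr (_.[_]); apply/polyP => k; rewrite coef_sum.
case: (leqP k (a (dir i))) => [ka|ak]; last first.
  rewrite nth_default; last exact: leq_trans ak.
  rewrite big1 // => u _; rewrite coefZ /trace; case: ifP => _; rewrite ?coef0 ?mulr0 //.
  rewrite coefXn; case: eqP => [E|]; rewrite ?mulr0 //.
  by have := cycle_le cyc (dir i) (ltn_ord u); rewrite -E leqNgt ak.
have [j0 jD [jk jr]] := cycle_full cyc (ltn_ord i) ka.
pose j := Ordinal jD; have fj : on_face i (w j).
  by apply/forallP => r; case: eqVneq => //= rd; rewrite jr.
rewrite (bigD1 j) //= big1 ?addr0 => [|u uj]; last first.
  by rewrite coefZ -jk (@trace_cycle_coef i j u) // [_ == _ :> nat](negbTE uj) mulr0.
rewrite coefZ -[in RHS]jk (@trace_cycle_coef i j j) // eqxx mulr1.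
have [szQ sQ Qa] := hP j.
case: (eqVneq (dir j) (dir i)) => [Ed|Nd].
  rewrite Ed jk; suff -> : P i = P j by []; apply: horner_inj => t'.
  rewrite -sP -sQ; apply: (eq_p1point _ seq) => r; rewrite /upd Ed.
  by case: eqVneq => // rd; rewrite /corner jr.
rewrite (corner_coef sP Pa); last first.
  by rewrite -jk; apply: (cycle_face cyc (i := j)); rewrite // eq_sym.
rewrite (corner_coef sQ Qa); last first.
  by rewrite jr //; apply: (cycle_face cyc (i := i)).
apply: (eq_p1point _ seq) => r; rewrite /upd /corner.
case: (eqVneq r (dir j)) => [->|rj]; first by rewrite (negbTE Nd) jr.
by case: eqVneq => [->|ri]; rewrite ?jk // jr.
Qed.

End Curves.

Section CycleBasis.
Variables (K : numClosedFieldType) (d : nat) (n a : 'I_d -> nat).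
Hypothesis n_gt0 : forall i, (0 < n i)%N.
Variables (D : nat) (w : nat -> 'I_d -> nat) (dir : nat -> 'I_d).
Hypothesis cyc : lattice_cycle a D w dir.
Variable o : 'I_d -> nat.
Hypotheses (o_le : forall r, (o r <= a r)%N).
Hypothesis o_off : forall j, (j < D)%N -> ~ o =1 w j.

(** The coefficients found in [section_on_cycle] form a linear map from H^0(L) to
    K^D.  It sends the monomials of the cycle to the standard basis and its
    kernel consists of the sections that vanish on the edges, such as the
    monomial with exponents [o]. *)
Lemma cycle_basis N (sigma : 'I_N -> hcoord K n -> K) :
    is_basis (section_ring (K := K) (n := n) a) sigma ->
  (D < N)%N /\ exists B C : 'M[K]_N,
    let tau := new_basis B sigma in
    [/\ B *m C = 1%:M, C *m B = 1%:M,
        forall t : 'I_N, (t < D)%N -> tau t =1 mono a 1 (w t),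
        forall t : 'I_N, t = D :> nat -> tau t =1 mono a 1 o &
        forall (t : 'I_N) i z, (D <= t)%N -> (i < D)%N ->
          tau t (curve n_gt0 w dir i z) = 0].
Proof.
move=> [sigG sigB].
have mono1 e : (forall r, (e r <= a r)%N) -> section_ring (K := K) (n := n) a 1 (mono a 1 e).
  by move=> ea; apply: (@section_mono K d n a 1 e) => r; rewrite mul1n.
have /fin_all_exists [A0 hA0] : forall j : 'I_N, exists b : 'I_D -> K, forall i t, (i < D)%N ->
    sigma j (curve n_gt0 w dir i t) = (\sum_u b u *: trace K w dir i (w u)).[t].
  by move=> j; apply: (section_on_cycle n_gt0 cyc (sigG j)).
pose A := \matrix_(j, u) A0 j u.
pose sec (c : 'rV[K]_N) x := \sum_j c 0 j * sigma j x.
have secA c i t : (i < D)%N -> sec c (curve n_gt0 w dir i t) =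
    (\sum_u (c *m A) 0 u *: trace K w dir i (w u)).[t].
  move=> iD; rewrite /sec horner_sum.
  under eq_bigr => j _ do rewrite hA0 // horner_sum mulr_sumr.
  rewrite exchange_big; apply: eq_bigr => u _; rewrite mxE scaler_suml horner_sum.
  by apply: eq_bigr => j _; rewrite !hornerZ mxE mulrA.
have secE c e (u : 'I_D) : (forall r, (e r <= a r)%N) -> mono a 1 e =1 sec c ->
    (c *m A) 0 u = (trace K w dir u e)`_(w u (dir u)).
  move=> ea ec; have -> : trace K w dir u e = \sum_v (c *m A) 0 v *: trace K w dir u (w v).
    by apply: horner_inj => t; rewrite -secA // -ec (mono_curve n_gt0 cyc).
  rewrite coef_sum (bigD1 u) //= big1 ?addr0 => [|v vu].
    by rewrite coefZ (trace_cycle_coef K cyc) ?on_face_self // eqxx mulr1.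
  rewrite coefZ (trace_cycle_coef K cyc) ?on_face_self //.
  by rewrite [_ == _ :> nat](negbTE vu) mulr0.
have /fin_all_exists [R0 hR0] : forall i : 'I_D, exists c, mono a 1 (w i) =1 sec c.
  move=> i; have [|c [hc _]] := sigB (mono a 1 (w i)); last by exists c.
  by apply: mono1 => r; apply: (cycle_le cyc).
pose R := \matrix_(i < D) R0 i.
have [v [hv _]] := sigB _ (mono1 o o_le).
have RA : R *m A = 1%:M.
  apply/row_matrixP => i; rewrite row_mul rowK; apply/rowP => u.
  rewrite (secE _ _ _ _ (hR0 i)) => [|r]; last exact: (cycle_le cyc).
  by rewrite (trace_cycle_coef K cyc) ?on_face_self // !mxE.
have vA : v *m A = 0.
  apply/rowP => u; rewrite (secE _ _ _ o_le hv) (trace_off_cycle K cyc) //.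
  by rewrite coef0 mxE.
have v0 : v != 0.
  apply/eqP => v0; have /eqP := hv (p1point n_gt0 (fun=> (false, 1))).
  rewrite mono_p1point big1 => [|r _]; last by rewrite expr1n.
  by rewrite v0 big1 ?oner_eq0 // => j _; rewrite mxE mul0r.
have [DN [B [Bu BR Bv BA]]] := adapted_basis RA vA v0.
split=> //; exists B, (invmx B) => tau.
have tauE t x : tau t x = sec (row t B) x by apply: eq_bigr => j _; rewrite mxE.
split; rewrite ?mulmxV ?mulVmx //.
- by move=> t tD x; rewrite tauE (BR t (Ordinal tD)) // rowK -hR0.
- by move=> t tD x; rewrite tauE (Bv t tD) // -hv.
- move=> t i z Dt iD; rewrite tauE secA // BA // big1 ?horner0 // => u _.
  by rewrite mxE scale0r.
Qed.

End CycleBasis.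

Lemma koszul_neq0 (N : nat) (R : comNzRingType) (M : lmodType R) (l : 'I_N -> R)
    (f : {set 'I_N} -> M) F : koszul l f F != 0 ->
  exists t, [/\ t \notin F, l t != 0 & f (t |: F) != 0].
Proof.
move=> nz.
have [t /and3P[tF lt ft]|h] := pickP [pred t | [&& t \notin F, l t != 0 & f (t |: F) != 0]].
  by exists t.
case/eqP: nz; rewrite /koszul big1 // => t tF.
have := h t; rewrite /= tF; case: eqVneq => [->|_]; first by rewrite scale0r scaler0.
by case: eqVneq => // ->; rewrite !scaler0.
Qed.

Lemma card_below N k : (k <= N)%N -> #|[set t : 'I_N | (t < k)%N]| = k.
Proof.
move=> kN; rewrite -sum1_card (eq_bigl (fun t : 'I_N => t < k)%N); last first.
  by move=> t; rewrite inE.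
by rewrite -(big_ord_widen _ (fun=> 1%N) kN) sum1_card card_ord.
Qed.

(** * A nontrivial Koszul class *)

Section Obstruction.
Variables (K : numClosedFieldType) (d : nat) (n a : 'I_d -> nat).
Hypothesis n_gt0 : forall i, (0 < n i)%N.
Variables (D : nat) (w : nat -> 'I_d -> nat) (dir : nat -> 'I_d).
Hypothesis cyc : lattice_cycle a D w dir.
Variable o : 'I_d -> nat.
Hypotheses (o_le : forall r, (o r <= a r)%N).
Hypothesis o_off : forall j, (j < D)%N -> ~ o =1 w j.
Hypothesis w0 : forall r, w 0 r = 0%N.
Variable c : nat.
Hypotheses (c_gt0 : (0 < c)%N) (cD : (c.+1 < D)%N).
Hypothesis cut : forall j k r, (0 < j <= c)%N -> (c < k < D)%N ->
  (o r <= w j r + w k r)%N.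

Section Chain.
Variables (N : nat) (DN : (D < N)%N).
Implicit Types (F : {set 'I_N}) (t u : 'I_N) (r : 'I_d) (i : nat).

Let N_gt0 : (0 < N)%N. Proof. exact: leq_ltn_trans DN. Qed.

Definition ord i : 'I_N := insubd (Ordinal N_gt0) i.

Lemma val_ord i : (i <= D)%N -> ord i = i :> nat.
Proof. by move=> iD; rewrite /ord val_insubd (leq_ltn_trans iD DN). Qed.

Lemma eq_ord t i : (i <= D)%N -> (t == ord i) = (t == i :> nat).
Proof. by move=> iD; rewrite -val_eqE /= val_ord. Qed.

(** The exponents of the basis elements: those before the [D]-th are the
    monomials of the cycle, and the [D]-th is the extra monomial. *)
Definition wt (t : nat) r : nat := if (t < D)%N then w t r else o r.

Lemma wt_le t r : (wt t r <= a r)%N.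
Proof. by rewrite /wt; case: ifP => tD //; apply: (cycle_le cyc). Qed.

Definition cycle_set : {set 'I_N} := [set t : 'I_N | (t < D)%N].

(** The lattice points of the cycle with [w 0] replaced by the extra point. *)
Definition span_set : {set 'I_N} := [set t : 'I_N | (0 < t <= D)%N].

Definition weight F r : nat := \sum_(t in F) wt t r.

Lemma weightU1 t F r : t \notin F -> weight (t |: F) r = (wt t r + weight F r)%N.
Proof. exact: big_setU1. Qed.

Lemma weight_span r : weight span_set r = (o r + weight cycle_set r)%N.
Proof.
have -> : span_set = ord D |: (cycle_set :\ ord 0).
  by apply/setP => t; rewrite !inE !eq_ord //; lia.
rewrite weightU1; last by rewrite !inE val_ord // ltnn andbF.
rewrite /weight [in RHS](big_setD1 (ord 0)) /=; last by rewrite inE val_ord //; lia.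
have -> : wt (ord 0) r = 0%N by rewrite /wt val_ord // w0; case: ifP; lia.
by have -> : wt (ord D) r = o r by rewrite /wt val_ord // ltnn.
Qed.

Definition before_cut t : K := (0 < t <= c)%N%:R.
Definition after_cut t : K := (~~ (0 < t <= c)%N)%:R.

(** Taking the boundary of the simplex [span_set] twice removes two vertices in
    both orders and gives 0.  Here the first vertex is removed among those before
    the cut and the second one among the others, which selects one of the two
    orders and leaves a chain that is no longer 0 but still a cycle. *)
Definition cut_chain : {set 'I_N} -> K^o :=
  koszul after_cut (koszul before_cut (fun F => (F == span_set)%:R : K^o)).

Lemma cut_chain_cycle F : koszul (fun=> 1 : K) cut_chain F = 0.
Proof.
(* Removing a second vertex before the cut contributes nothing, because the
   differential of [before_cut] squares to 0. *)
have E F' : cut_chain F' = koszul (fun=> 1 : K)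
    (koszul before_cut (fun F => (F == span_set)%:R : K^o)) F'.
  pose g := koszul before_cut (fun F => (F == span_set)%:R : K^o).
  have -> : koszul (fun=> 1 : K) g F' =
            koszul (fun t => before_cut t + after_cut t) g F'.
    apply: eq_bigr => t _; congr (_ *: (_ *: _)).
    by rewrite /before_cut /after_cut; case: (_ && _); rewrite ?addr0 ?add0r.
  by rewrite koszulDl /g koszulK add0r.
apply: etrans (koszulK (fun=> 1 : K)
  (koszul before_cut (fun F => (F == span_set)%:R : K^o)) F).
by apply: eq_koszul => t _; apply: E.
Qed.

Lemma cut_chain_support F : cut_chain F != 0 -> exists t u,
  [/\ t \notin F, u \notin t |: F, ~~ (0 < t <= c)%N, (0 < u <= c)%N &
      u |: (t |: F) = span_set].
Proof.
have bool0 (b : bool) : b%:R != 0 :> K -> b by case: b; rewrite ?eqxx.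
case/koszul_neq0 => t [tF /bool0 tc /koszul_neq0[u [uF /bool0 uc /bool0/eqP E]]].
by exists t, u.
Qed.

(** The total weight of the cycle minus that of [F] is wt t + wt u - o, where [t]
    and [u] are the removed vertices; the hypothesis on the cut says that this is
    an exponent vector. *)
Lemma cut_chain_weight F r : cut_chain F != 0 ->
  (weight F r <= weight cycle_set r)%N /\
  (weight cycle_set r - weight F r <= 2 * a r)%N.
Proof.
case/cut_chain_support => t [u [tF uF tc uc E]].
have := weight_span r; rewrite -E !weightU1 // => wE.
have tS : t \in span_set by rewrite -E !inE eqxx orbT.
have : (o r <= wt u r + wt t r)%N.
  move: tS; rewrite inE => tD; rewrite /wt; have -> : (u < D)%N by lia.
  by case: ifP => tD'; [apply: cut => //; lia | lia].
move: (wt_le u r) (wt_le t r) wE; lia.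
Qed.

(** The coefficient of a chain of weight [weight cycle_set] at the exterior
    monomial [F] is a multiple of the monomial with these exponents. *)
Definition residual F r : nat := (weight cycle_set r - weight F r)%N.

Lemma residualU1 t F r : t \notin F -> cut_chain (t |: F) != 0 ->
  residual F r = (wt t r + residual (t |: F) r)%N.
Proof.
move=> tF /(cut_chain_weight r) [le _]; move: le.
by rewrite /residual weightU1 //; lia.
Qed.

(** The exterior monomial that misses the two ends of the i-th step of the
    cycle. *)
Definition edge_set i : {set 'I_N} := (cycle_set :\ ord i) :\ ord (i.+1 %% D)%N.

Lemma next_lt i : (i.+1 %% D < D)%N.
Proof. by rewrite ltn_mod; lia. Qed.

Lemma next_neq i : (i < D)%N -> (i.+1 %% D)%N != i.
Proof.
move=> iD; case: (ltnP i.+1 D) => iD'; first by rewrite modn_small //; lia.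
have -> : i.+1 = D by lia.
by rewrite modnn; lia.
Qed.

Lemma edge_setP i : (i < D)%N ->
  [/\ ord i \notin edge_set i, ord (i.+1 %% D)%N \notin edge_set i,
      ord i |: edge_set i = cycle_set :\ ord (i.+1 %% D)%N &
      ord (i.+1 %% D)%N |: edge_set i = cycle_set :\ ord i].
Proof.
move=> iD; rewrite /edge_set; move: (next_neq iD) (next_lt i).
move: (i.+1 %% D)%N => j ji jD; split.
- by rewrite !inE eqxx andbF.
- by rewrite !inE eqxx.
- by apply/setP => t; rewrite !inE !eq_ord //; lia.
- by apply/setP => t; rewrite !inE !eq_ord //; lia.
Qed.

Lemma card_edge_set i : (i < D)%N -> #|edge_set i| = (D - 2)%N.
Proof.
move=> iD; have [_ jF _ E] := edge_setP iD.
have := cardsD1 (ord i) cycle_set; rewrite card_below; last exact: ltnW.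
have -> : ord i \in cycle_set by rewrite inE val_ord // ltnW.
rewrite -E cardsU1 jF /= => DE; have D2 : (2 <= D)%N by lia.
by apply: (@addnI 2); rewrite subnKC.
Qed.

Lemma nbefore_edge i : (i.+1 < D)%N ->
  nbefore (ord i) (edge_set i) = i /\ nbefore (ord (i.+1 %% D)%N) (edge_set i) = i.
Proof.
move=> iD; rewrite /edge_set modn_small //.
have cardi := @card_below N i; split; rewrite -[RHS]cardi; try lia.
  by apply: eq_card => t; rewrite !inE !eq_ord ?val_ord //; lia.
by apply: eq_card => t; rewrite !inE !eq_ord ?val_ord //; lia.
Qed.

Lemma nbefore_last :
  nbefore (ord D.-1) (edge_set D.-1) = (D - 2)%N /\
  nbefore (ord (D.-1.+1 %% D)%N) (edge_set D.-1) = 0%N.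
Proof.
have D1 : (D.-1 < D)%N by lia.
rewrite -(card_edge_set D1) /edge_set prednK ?modnn; last by lia.
split; last first.
  by apply/eqP; rewrite cards_eq0; apply/eqP/setP => t; rewrite !inE !eq_ord ?val_ord //; lia.
by apply: eq_card => t; rewrite !inE !eq_ord ?val_ord //; lia.
Qed.

Lemma residual_edge i r : (i < D)%N ->
  residual (edge_set i) r = (w i r + w (i.+1 %% D)%N r)%N.
Proof.
move=> iD; have [iF jF _ E] := edge_setP iD.
rewrite /residual (_ : weight cycle_set r = wt (ord i) r + weight (cycle_set :\ ord i) r)%N.
  have wtE k : (k < D)%N -> wt (ord k) r = w k r.
    by move=> kD; rewrite /wt val_ord ?kD // ltnW.
  by rewrite -E weightU1 // !wtE ?next_lt // addnA addnK.
by rewrite /weight (big_setD1 (ord i)) //= inE val_ord // ltnW.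
Qed.

Lemma cut_chain_edge0 i : (0 < i < D)%N -> cut_chain (edge_set i) = 0.
Proof.
move=> /andP[i0 iD]; apply/eqP; apply: contraT => /cut_chain_support.
move=> [t [u [tF uF tc uc /setP E]]].
have := E (ord D.-1); have := E (ord 0); have := E (ord D).
move: (next_neq iD) (next_lt i); rewrite /edge_set !inE !eq_ord ?val_ord //; try lia.
have [jE|/eqP jE] := eqVneq i D.-1.
  by rewrite jE prednK ?modnn; last lia; rewrite ![_ == t]eq_sym ![_ == u]eq_sym !eq_ord; lia.
rewrite modn_small; last by lia.
by rewrite ![_ == t]eq_sym ![_ == u]eq_sym !eq_ord; lia.
Qed.

Lemma cut_chain_edge : cut_chain (edge_set 0) != 0.
Proof.
have sgn0 m (x : K) : (-1) ^+ m * x != 0 = (x != 0) by rewrite mulf_eq0 signr_eq0.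
have F0 : edge_set 0 = (cycle_set :\ ord 0) :\ ord 1.
  by rewrite /edge_set modn_small //; lia.
have DF : ord D \notin edge_set 0 by rewrite F0 !inE !eq_ord ?val_ord //; lia.
have oneF : ord 1 \notin ord D |: edge_set 0.
  by rewrite F0 !inE !eq_ord ?val_ord ?eqxx //; lia.
have E : ord 1 |: (ord D |: edge_set 0) = span_set.
  by apply/setP => t; rewrite F0 !inE !eq_ord //; lia.
have uniqE t u : u \notin t |: edge_set 0 -> ~~ (0 < t <= c)%N -> (0 < u <= c)%N ->
    u |: (t |: edge_set 0) = span_set -> t = ord D /\ u = ord 1.
  move=> uF tc uc /setP E'; have := E' (ord D); have := E' (ord 1).
  rewrite F0 !inE !eq_ord ?val_ord //; try lia.
  rewrite ![_ == t]eq_sym ![_ == u]eq_sym !eq_ord; try lia.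
  by move=> h1 h2; split; apply/eqP; rewrite eq_ord; lia.
rewrite /cut_chain koszulE (bigD1 (ord D)) //= big1 ?addr0 => [|t /andP[tF tD]].
  rewrite koszulE (bigD1 (ord 1)) //= big1 ?addr0 => [|u /andP[uF u1]].
    rewrite E eqxx /before_cut /after_cut !val_ord //; last by lia.
    rewrite (_ : (0 < 1 <= c)%N); last by lia.
    rewrite (_ : (0 < D <= c)%N = false); last by lia.
    by rewrite /GRing.scale /= !mulr1 sgn0 signr_eq0.
  rewrite /before_cut; case: (boolP (0 < u <= c)%N) => uc; last by rewrite mulr0 scale0r.
  case: eqP => [E'|_]; last by rewrite scaler0.
  have [|_ u1'] := uniqE (ord D) u uF _ uc E'; first by rewrite val_ord //; lia.
  by rewrite u1' eqxx in u1.
apply/eqP; rewrite scaler_eq0; apply/norP => -[/eqP l0].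
case/koszul_neq0 => u [uF].
rewrite /before_cut; case: (boolP (0 < u <= c)%N) => uc; last by rewrite eqxx.
move=> _; case: (eqVneq (u |: (t |: edge_set 0)) span_set) => [E' _|_]; last by rewrite eqxx.
move: l0; rewrite /after_cut; case: (boolP (0 < t <= c)%N) => tc; first by rewrite mulr0.
by have [t1 _] := uniqE t u uF tc uc E'; rewrite t1 eqxx in tD.
Qed.

Section Class.
Variables (sigma : 'I_N -> hcoord K n -> K) (B : 'M[K]_N).
Notation tau := (new_basis B sigma).
Hypothesis tau_w : forall t, (t < D)%N -> tau t =1 mono a 1 (w t).
Hypothesis tau_o : forall t, t = D :> nat -> tau t =1 mono a 1 o.
Hypothesis tau_off : forall t i x, (D <= t)%N -> (i < D)%N ->
  tau t (curve n_gt0 w dir i x) = 0.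

Definition koszul_class F (x : hcoord K n) : K := cut_chain F * mono a 2 (residual F) x.

Lemma koszul_class_section F : section_ring a 2 (koszul_class F).
Proof.
have [F0|F0] := eqVneq (cut_chain F) 0; last first.
  apply: sectionZ; apply: (@section_mono K d n a 2) => r.
  by have [] := cut_chain_weight r F0.
apply: (eq_section (s := fun x => 0 * mono a 2 (fun=> 0%N) x)).
  by move=> x; rewrite /koszul_class F0 !mul0r.
exact/sectionZ/(@section_mono K d n a 2).
Qed.

Lemma koszul_class_cycle F x :
  koszul (tau^~ x) (fun F' => koszul_class F' x : K^o) F = 0.
Proof.
have E : koszul (tau^~ x) (fun F' => koszul_class F' x : K^o) F =
         mono a 3 (residual F) x * koszul (fun=> 1 : K) cut_chain F.
  rewrite mulr_sumr; apply: eq_bigr => t tF; rewrite /koszul_class /GRing.scale /=.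
  have [->|nz] := eqVneq (cut_chain (t |: F)) 0; first by rewrite mul0r !mulr0.
  have tD : (t <= D)%N.
    have [v [u [_ _ _ _ /setP /(_ t)]]] := cut_chain_support nz.
    by rewrite !inE eqxx !orbT => /esym /andP[].
  have -> : tau t x = mono a 1 (wt t) x.
    rewrite /wt; move: tD; rewrite leq_eqVlt => /orP[/eqP tD|tD].
      by rewrite tD ltnn; apply: tau_o.
    by rewrite tD; apply: tau_w.
  have -> : mono a 3 (residual F) x = mono a 3 (fun r => (wt t r + residual (t |: F) r)%N) x.
    by apply: eq_mono => r; apply: residualU1.
  rewrite -[3%N]/(1 + 2)%N -monoM; first by ring.
    by move=> r; rewrite mul1n wt_le.
  by move=> r; have [_] := cut_chain_weight r nz.
by rewrite E cut_chain_cycle mulr0.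
Qed.

(** If the class is the boundary of [b], look at its component at [edge_set i]
    along the line through w i and its successor w j.  The basis elements outside
    the cycle vanish there, so only two terms remain on the left; the
    coefficient of the product of the monomials w i and w j in them comes from
    the entries of [b] at w j and at w i. *)
Lemma edge_relation (b : {set 'I_N} -> 'I_N -> K) i : (i < D)%N ->
    (forall x, koszul (tau^~ x) (fun F => \sum_u b F u * tau u x : K^o) (edge_set i) =
       koszul_class (edge_set i) x) ->
  (-1) ^+ nbefore (ord i) (edge_set i) *
    b (cycle_set :\ ord (i.+1 %% D)%N) (ord (i.+1 %% D)%N) +
  (-1) ^+ nbefore (ord (i.+1 %% D)%N) (edge_set i) *
    b (cycle_set :\ ord i) (ord i) = cut_chain (edge_set i).
Proof.
move=> iD bz; have [iF jF Ei Ej] := edge_setP iD.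
have jD := next_lt i; have ji := next_neq iD; have fj := on_face_next cyc iD.
have resE r : residual (edge_set i) r = (w i r + w (i.+1 %% D)%N r)%N.
  exact: residual_edge.
move: (i.+1 %% D)%N jD ji fj resE iF jF Ei Ej => j jD ji fj resE iF jF Ei Ej.
pose T (t : 'I_N) : {poly K} := if (t < D)%N then trace K w dir i (w t) else 0.
have tauT t x : tau t (curve n_gt0 w dir i x) = (T t).[x].
  rewrite /T; case: ltnP => tD; last by rewrite horner0 tau_off.
  by rewrite tau_w // (mono_curve n_gt0 cyc) // => r; apply: (cycle_le cyc).
have Tord k : (k < D)%N -> on_face w dir i (w k) -> T (ord k) = 'X^(w k (dir i)).
  by move=> kD fk; rewrite /T val_ord; [rewrite kD /trace fk | exact: ltnW].
have coefT k F : (k < D)%N -> on_face w dir i (w k) ->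
    (\sum_u b F u *: T u)`_(w k (dir i)) = b F (ord k).
  move=> kD fk; rewrite coef_sum (bigD1 (ord k)) //= big1 ?addr0 => [|u uk].
    by rewrite Tord // coefZ coefXn eqxx mulr1.
  rewrite coefZ /T; case: ltnP => uD; last by rewrite coef0 mulr0.
  rewrite (trace_cycle_coef K cyc) // -eq_ord ?(negbTE uk) ?mulr0 //.
  exact: ltnW.
have fi := on_face_self w dir i.
pose L F : {poly K} := \sum_u b F u *: T u.
have LE F x : \sum_u b F u * tau u (curve n_gt0 w dir i x) = (L F).[x].
  by rewrite horner_sum; apply: eq_bigr => u _; rewrite hornerZ tauT.
have PE : (-1) ^+ nbefore (ord i) (edge_set i) *: ('X^(w i (dir i)) * L (cycle_set :\ ord j)) +
   (-1) ^+ nbefore (ord j) (edge_set i) *: ('X^(w j (dir i)) * L (cycle_set :\ ord i)) =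
   cut_chain (edge_set i) *: ('X^(w i (dir i)) * 'X^(w j (dir i))).
  apply: horner_inj => x; have := bz (curve n_gt0 w dir i x).
  have wi r : (w i r <= a r)%N by apply: (cycle_le cyc).
  have wj r : (w j r <= a r)%N by apply: (cycle_le cyc).
  have -> : koszul_class (edge_set i) (curve n_gt0 w dir i x) =
      cut_chain (edge_set i) * ((T (ord i)).[x] * (T (ord j)).[x]).
    rewrite /koszul_class -!tauT.
    rewrite !tau_w ?val_ord //; try exact: ltnW.
    rewrite monoM => [|r|r]; rewrite ?mul1n //.
    by congr (_ * _); apply: eq_mono.
  rewrite !Tord //.
  rewrite !(hornerD, hornerZ, hornerM) => <-.
  rewrite koszulE (bigD1 (ord i)) //= [X in _ = _ + X](bigD1 (ord j)) /=; last first.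
    by rewrite jF eq_ord ?val_ord // ltnW.
  rewrite [X in _ + (_ + X)]big1 ?addr0 => [|t /andP[/andP[tF ti] tj]]; last first.
    rewrite tauT /T; case: ltnP => tD; last by rewrite horner0 mulr0 scale0r.
    by have /setP/(_ t) := Ei; rewrite in_setU1 (negbTE ti) (negbTE tF) in_setD1 tj inE tD.
  by rewrite Ei Ej !LE !tauT !Tord //  /GRing.scale /= !hornerXn !mulrA.
have := congr1 (fun P : {poly K} => P`_(w i (dir i) + w j (dir i))) PE.
rewrite /= coefD !coefZ -exprD coefXn eqxx mulr1 => <-.
congr (_ * _ + _ * _).
  by rewrite coefXnM addKn ltnNge leq_addr /= coefT.
by rewrite addnC coefXnM addKn ltnNge leq_addr /= coefT.
Qed.

(** Along the steps from 1 to D - 1 the numbers [be i] alternate in sign, and the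
    step from D - 1 to 0 closes up to the relation be 1 + be 0 = 0, whereas the
    step from 0 to 1 says that this sum is not 0. *)
Lemma koszul_class_not_boundary (b : {set 'I_N} -> 'I_N -> K) :
  ~ (forall F x, #|F| = (D - 2)%N ->
       koszul (tau^~ x) (fun F => \sum_u b F u * tau u x : K^o) F = koszul_class F x).
Proof.
move=> bz; pose be i := b (cycle_set :\ ord i) (ord i).
have rel i (iD : (i < D)%N) := @edge_relation b i iD (fun x => bz _ x (card_edge_set iD)).
have rel0 : be 1%N + be 0%N = cut_chain (edge_set 0).
  have D1 : (1 < D)%N by lia.
  have := rel 0%N (ltnW D1); have [-> ->] := nbefore_edge D1.
  by rewrite modn_small // !mul1r.
have relS i : (0 < i)%N -> (i.+1 < D)%N -> be i.+1 = - be i.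
  move=> i0 iD; have := rel i (ltnW iD); have [-> ->] := nbefore_edge iD.
  rewrite cut_chain_edge0; last by rewrite i0 ltnW.
  rewrite modn_small // -mulrDr => /eqP.
  by rewrite mulf_eq0 signr_eq0 /= addr_eq0 => /eqP.
have beE i : (i.+1 < D)%N -> be i.+1 = (-1) ^+ i * be 1%N.
  elim: i => [|i IHi] iD; first by rewrite mul1r.
  by rewrite relS // IHi ?exprS ?mulN1r ?mulNr // ltnW.
have D1 : (D.-1 < D)%N by lia.
have := rel _ D1; have [-> ->] := nbefore_last.
rewrite cut_chain_edge0; last by lia.
rewrite prednK ?modnn; last by lia.
rewrite -/(be 0%N) -/(be D.-1).
have -> : D.-1 = (D - 2).+1 by lia.
rewrite beE; last by lia.
rewrite expr0 mul1r -mulrDr => /eqP; rewrite mulf_eq0 signr_eq0 /= addrC rel0.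
by rewrite (negbTE cut_chain_edge).
Qed.

End Class.
End Chain.

End Obstruction.

(** The points [w 1, ..., w c] of the cycle and the remaining ones are separated
    by the cut at [c]: the monomial with exponents [o] divides the product of any
    two monomials from different sides. *)
Lemma cycle_not_propertyN (K : numClosedFieldType) (d : nat) (n a : 'I_d -> nat)
    (D : nat) (w : nat -> 'I_d -> nat) (dir : nat -> 'I_d) (o : 'I_d -> nat) (c : nat) :
    (forall i, (0 < n i)%N) ->
    lattice_cycle a D w dir ->
    (forall r, (o r <= a r)%N) -> (forall j, (j < D)%N -> ~ o =1 w j) ->
    (forall r, w 0 r = 0%N) -> (0 < c)%N -> (c.+1 < D)%N ->
    (forall j k r, (0 < j <= c)%N -> (c < k < D)%N -> (o r <= w j r + w k r)%N) ->
  ~ line_bundle_propertyN K n a (D - 2).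
Proof.
move=> n_gt0 cyc o_le o_off w0 c_gt0 cD cut.
move=> [N [sigma [E [basis [rk0 shift0] shiftN]]]].
have [DN [B [C [BC CB tau_w tau_o tau_off]]]] := cycle_basis n_gt0 cyc o_le o_off basis.
have [||F _|F x _|b hb] := koszul_vanishing BC CB (E := E) (p := (D - 2)%N) _ rk0 shift0
   _ (z := fun F x => koszul_class a D w o c F x).
- case=> [|i] ip k; first by rewrite shift0.
  by rewrite shiftN //; lia.
- apply: (eq_section (s := mono a 0 (fun=> 0%N))); first exact: mono0.
  exact: (@section_mono K d n a 0).
- exact: (koszul_class_section K n cyc o_le w0 c_gt0 cD cut DN).
- exact: (koszul_class_cycle cyc o_le w0 c_gt0 cD cut DN tau_w tau_o).
exact: (koszul_class_not_boundary cyc c_gt0 cD DN tau_w tau_off hb).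
Qed.

(** * Lattice paths along the edges of a box *)

Section Walk.
Variables (d : nat) (a len : 'I_d -> nat).
Hypothesis len_a : forall r, len r = 0%N \/ len r = a r.

(** The time at which the path starts to climb in the direction [k]. *)
Definition offset k : nat := \sum_(r < d | (r < k)%N) len r.

Definition climb : nat := \sum_(r < d) len r.

Lemma offsetS (r : 'I_d) : offset r.+1 = (offset r + len r)%N.
Proof.
rewrite /offset (bigD1 r) //= addnC; congr (_ + _)%N; apply: eq_bigl => s.
by rewrite -val_eqE /=; lia.
Qed.

Lemma offset_mono k l : (k <= l)%N -> (offset k <= offset l)%N.
Proof.
move=> kl; rewrite /offset [X in (_ <= X)%N](bigID (fun r : 'I_d => r < k)%N) /=.
rewrite (eq_bigl (fun r : 'I_d => (r < l) && (r < k))%N) ?leq_addr // => r.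
by lia.
Qed.

Lemma offset_max : offset d = climb.
Proof. by apply: eq_bigl => r; rewrite ltn_ord. Qed.

Lemma offset_lt (r s : 'I_d) : (r < s)%N -> (offset r + len r <= offset s)%N.
Proof. by move=> rs; rewrite -offsetS offset_mono. Qed.

Lemma offset_sep (r s : 'I_d) : r != s ->
  (offset r + len r <= offset s \/ offset s + len s <= offset r)%N.
Proof.
move=> rs; case: (ltngtP r s) => [|/offset_lt|/val_inj E]; [move/offset_lt; by left | by right |].
by rewrite E eqxx in rs.
Qed.

Lemma offset_climb (r : 'I_d) : (offset r + len r <= climb)%N.
Proof. by rewrite -offsetS -offset_max offset_mono. Qed.

(** The lattice path that first climbs from 0 by [len r] in every direction [r],
    in increasing order of [r], and then descends in the same order of the
    directions. *)
Definition walk i (r : 'I_d) : nat :=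
  (minn (len r) (i - offset r) - minn (len r) (i - climb - offset r))%N.

Lemma climb_dir i : (i < climb)%N ->
  exists r : 'I_d, (offset r <= i < offset r + len r)%N.
Proof.
rewrite -offset_max => id; have ex : exists k, (i < offset k)%N by exists d.
case: (ex_minnP ex) => k ik kmin.
have kd : (k <= d)%N by apply: kmin.
case: k ik kmin kd => [|k] ik kmin kd; first by rewrite /offset big1 // in ik.
exists (Ordinal kd); rewrite -offsetS ik andbT leqNgt; apply/negP => /kmin.
by rewrite ltnn.
Qed.

Lemma walk_le i r : (walk i r <= a r)%N.
Proof.
have : (walk i r <= len r)%N by rewrite /walk; lia.
by case: (len_a r) => ->; lia.
Qed.

Lemma walk0 r : walk 0 r = 0%N.
Proof. by rewrite /walk; lia. Qed.

Lemma walk_up i r : (i <= climb)%N -> walk i r = minn (len r) (i - offset r).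
Proof. by rewrite /walk; lia. Qed.

Lemma walk_down i r : (climb <= i)%N ->
  walk i r = (len r - minn (len r) (i - climb - offset r))%N.
Proof. by move=> hi; have := offset_climb r; rewrite /walk; lia. Qed.

Lemma walk_end r : walk (climb + climb)%N r = 0%N.
Proof. by rewrite /walk addnK; have := offset_climb r; lia. Qed.

Variables (f g : 'I_d).
Hypotheses (fg : (f < g)%N) (len_f : (0 < len f)%N) (len_g : (0 < len g)%N).
Hypothesis len_lt : forall r : 'I_d, (r < f)%N -> len r = 0%N.
Hypothesis len_gt : forall r : 'I_d, (g < r)%N -> len r = 0%N.

Lemma offset_first : offset f = 0%N.
Proof. by rewrite /offset big1. Qed.

Lemma offset_last : (offset g + len g)%N = climb.
Proof.
rewrite -offsetS /offset /climb [RHS](bigID (fun r : 'I_d => r < g.+1)%N) /=.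
by rewrite [X in (_ + X)%N]big1 ?addn0 // => r; rewrite -leqNgt => /len_gt.
Qed.

(** The default [f] is never used for [i < climb + climb]. *)
Definition walk_dir i : 'I_d :=
  odflt f [pick r : 'I_d |
    offset r <= (if i < climb then i else i - climb) < offset r + len r]%N.

Lemma walk_dirP i : (i < climb + climb)%N ->
  (offset (walk_dir i) <= (if i < climb then i else i - climb)
     < offset (walk_dir i) + len (walk_dir i))%N.
Proof.
move=> iD; rewrite /walk_dir; case: pickP => // no.
have [|r rP] := @climb_dir (if i < climb then i else i - climb)%N.
  by case: (ltnP i climb); lia.
by rewrite no in rP.
Qed.

Lemma walk_face i r : (i < climb + climb)%N -> r != walk_dir i ->
  walk i.+1 r = walk i r /\ (walk i r = 0%N \/ walk i r = a r).
Proof.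
move=> iD rd; have := walk_dirP iD; have := offset_climb r; have := offset_climb (walk_dir i).
have := offset_sep rd.
move=> sep dc rc; case: (ltnP i climb) => ic dP.
  rewrite !walk_up; [|lia..]; case: sep => sep; split; try lia.
  by case: (len_a r); lia.
rewrite !walk_down; [|lia..]; case: sep => sep; split; try lia.
by case: (len_a r); lia.
Qed.

Lemma walk_full i k : (i < climb + climb)%N -> (k <= a (walk_dir i))%N ->
  exists2 j, (j < climb + climb)%N & walk j (walk_dir i) = k /\
    (forall r, r != walk_dir i -> walk j r = walk i r).
Proof.
move=> iD ka; have dP := walk_dirP iD; have dh := offset_climb (walk_dir i).
have la : len (walk_dir i) = a (walk_dir i).
  by case: (len_a (walk_dir i)) => // l0; move: dP; lia.
have sep r : r != walk_dir i -> _ := @offset_sep r (walk_dir i).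
case: (ltnP i climb) dP => [ih|hi] dP.
  exists (offset (walk_dir i) + k)%N; first by lia.
  split; first by rewrite walk_up; lia.
  by move=> r /sep [rd|rd]; rewrite !walk_up; lia.
pose j := (climb + offset (walk_dir i) + (len (walk_dir i) - k))%N.
have [jE|jD] := eqVneq j (climb + climb)%N.
  exists 0%N; first by lia.
  split=> [|r /sep rd]; first by rewrite walk0; lia.
  by rewrite walk0 walk_down //; have := offset_climb r; case: rd; lia.
exists j; first by lia.
have hj : (climb <= j)%N by rewrite /j; lia.
split=> [|r /sep rd]; first by rewrite walk_down // /j; lia.
by rewrite !walk_down //; case: rd => rd; rewrite /j; lia.
Qed.

(** Two points of the climb, or two points of the descent, differ in the direction
    of the earlier one.  A point i of the climb and a point j of the descent cannot
    agree: the last coordinate is positive at j, hence at i, so that the first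
    coordinate is maximal at i, hence at j; but the descent begins with that
    coordinate. *)
Lemma walk_inj i j : (i < climb + climb)%N -> (j < climb + climb)%N ->
  walk i =1 walk j -> i = j.
Proof.
wlog ij : i j / (i <= j)%N => [wl iD jD E|].
  by case: (leqP i j) => [ij|/ltnW ji]; [apply: wl | apply/esym/wl].
move=> iD jD E; have Ed := E (walk_dir i); have Ef := E f; have Eg := E g.
have := walk_dirP iD; have first := offset_first; have last := offset_last.
have fg' := offset_lt fg; have dc := offset_climb (walk_dir i).
case: (ltnP i climb) => ic dP; case: (ltnP j climb) => jc; [| |lia|].
- by move: Ed; rewrite !walk_up; lia.
- have : (0 < walk j g)%N by rewrite walk_down; lia.
  rewrite -Eg walk_up => [ig|]; last by lia.
  have jE : j = climb by move: Ef; rewrite walk_up ?walk_down; lia.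
  by move: Eg; rewrite jE walk_up ?walk_down; lia.
- by move: Ed; rewrite !walk_down; lia.
Qed.

Lemma walk_first j : (0 < j <= offset g)%N -> (0 < walk j f)%N.
Proof. by have := offset_first; have := offset_last; rewrite /walk; lia. Qed.

Lemma walk_last j : (offset g < j < climb + climb)%N -> (0 < walk j g)%N.
Proof. by have := offset_last; rewrite /walk; lia. Qed.

Lemma walk_cycle : lattice_cycle a (climb + climb) walk walk_dir.
Proof.
split; [by move=> i r _; apply: walk_le | exact: walk_inj | | | exact: walk_full].
- move=> i r iD rd; have [<- _] := walk_face iD rd.
  have [E|iD'] := eqVneq i.+1 (climb + climb)%N.
    by rewrite E modnn walk0 walk_end.
  by rewrite modn_small //; lia.
- by move=> i r iD rd; have [_] := walk_face iD rd.
Qed.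

Definition ends r : nat := ((r == f) || (r == g)).

(** At most one coordinate of a point of the path is neither 0 nor maximal, so
    the first and the last one cannot both be 1 if both maxima exceed 1.  And when
    both of them are positive, every coordinate in between is maximal. *)
Lemma ends_off j : (j < climb + climb)%N ->
    (exists2 r : 'I_d, (f < r < g)%N & (0 < len r)%N) \/ (1 < len f)%N /\ (1 < len g)%N ->
  ~ ends =1 walk j.
Proof.
move=> jD between E; have Ef := E f; have Eg := E g.
rewrite /ends !eqxx orbT /= in Ef Eg.
have first := offset_first; have last := offset_last.
case: between => [[r /andP[fr rg] r0]|[f1 g1]]; last first.
  have off_g := offset_lt fg.
  case: (leqP j climb) => jc; first by rewrite !walk_up // in Ef Eg; lia.
  by have hj := ltnW jc; rewrite !walk_down // in Ef Eg; lia.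
have Er : walk j r = 0%N.
  rewrite -E /ends -!val_eqE /=; lia.
have off_r := offset_lt fr; have off_g := offset_lt rg.
case: (leqP j climb) => jc; first by rewrite !walk_up // in Eg Er; lia.
by have hj := ltnW jc; rewrite !walk_down // in Ef Er; lia.
Qed.

End Walk.

(** The cut is made where the last direction of [B] starts to climb: the points
    before it, other than 0, have a positive first coordinate, and those after it
    a positive last coordinate. *)
Theorem product_not_propertyN (K : numClosedFieldType) (d : nat) (n a : 'I_d -> nat)
    (B : {set 'I_d}) (f g : 'I_d) :
    (forall i, (0 < n i)%N) -> (forall i, (0 < a i)%N) ->
    f \in B -> g \in B -> (f < g)%N -> (forall r, r \in B -> (f <= r <= g)%N) ->
    (2 < #|B|)%N \/ (1 < a f)%N /\ (1 < a g)%N ->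
  ~ line_bundle_propertyN K n a (2 * \sum_(r in B) a r - 2).
Proof.
move=> n_gt0 a_gt0 fB gB fg Bfg big.
pose len r := if r \in B then a r else 0%N.
have len_a r : len r = 0%N \/ len r = a r by rewrite /len; case: ifP; auto.
have len_f : (0 < len f)%N by rewrite /len fB.
have len_g : (0 < len g)%N by rewrite /len gB.
have len_lt (r : 'I_d) : (r < f)%N -> len r = 0%N.
  by rewrite /len; case: ifP => // /Bfg; lia.
have len_gt (r : 'I_d) : (g < r)%N -> len r = 0%N.
  by rewrite /len; case: ifP => // /Bfg; lia.
have -> : (2 * \sum_(r in B) a r - 2 = climb len + climb len - 2)%N.
  by rewrite mul2n -addnn /climb [X in (X + X)%N]big_mkcond.
have first := offset_first len_lt; have last := offset_last len_gt.
have := offset_lt len fg => off_fg.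
apply: (cycle_not_propertyN n_gt0 (walk_cycle len_a fg len_f len_g len_lt len_gt)
          (o := ends f g) (c := offset len g)).
- by move=> r; rewrite /ends; case: (_ || _).
- move=> j jD; apply: ends_off => //.
  case: big => [B3|[af ag]]; last by right; rewrite /len fB gB.
  left; have : (0 < #|B :\ f :\ g|)%N.
    have gf : g != f by apply: contraTneq fg => ->; rewrite ltnn.
    by rewrite (cardsD1 f) fB (cardsD1 g) in_setD1 gB gf in B3.
  rewrite card_gt0 => /set0Pn[r]; rewrite !inE => /and3P[rg rf rB].
  exists r; last by rewrite /len rB.
  have := Bfg r rB; rewrite -!val_eqE /= in rg rf; lia.
- exact: walk0.
- by lia.
- by lia.
move=> j k r jr kr; rewrite /ends.
have := walk_first fg len_f len_g len_lt len_gt jr.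
have := walk_last fg len_f len_g len_gt kr.
by case: eqVneq => [->|_]; [|case: eqVneq => [->|_]]; rewrite /=; lia.
Qed.

Theorem corollary8 (R : realType) (d : nat) (n a : 'I_d -> nat)
    (d_ge1 : (1 <= d)%N)
    (n_gt0 : forall i, (0 < n i)%N)
    (a_gt0 : forall i, (0 < a i)%N)
    (a_nondecreasing : forall i j : 'I_d, (i <= j)%N -> (a i <= a j)%N) :
  let k := (\max_(i < d | a i == 1) i.+1)%N in
  ((3 <= k)%N -> ~ line_bundle_propertyN R[i] n a 4) /\
  ((2 <= d - k)%N ->
     (* 0-based indices: a_{k+1} and a_{k+2} are the values of a at k and k+1 *)
     forall i1 i2 : 'I_d, i1 = k :> nat -> i2 = k.+1 :> nat ->
       ~ line_bundle_propertyN R[i] n a (2 * a i1 + 2 * a i2 - 2)).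
Proof.
move=> k.
have a_after (i : 'I_d) : (k <= i)%N -> (1 < a i)%N.
  move=> ki; have := a_gt0 i; rewrite leq_eqVlt => /orP[/eqP ai|//].
  have : (i.+1 <= k)%N by apply: leq_bigmax_cond; rewrite -ai.
  by rewrite ltnNge ki.
(* By monotonicity, a_i = 1 holds for all i below the index reaching the maximum. *)
have a_before (i : 'I_d) : (i < k)%N -> a i = 1%N.
  move=> ik; have [j aj ij] : exists2 j : 'I_d, a j = 1%N & (i <= j)%N.
    have [j aj|noj] := pickP (fun j : 'I_d => (a j == 1%N) && (i <= j)%N).
      by exists j; case/andP: aj => // /eqP.
    suff : (k <= i)%N by rewrite leqNgt ik.
    apply/bigmax_leqP => j aj; have := noj j.
    by rewrite aj ltnNge => /= ->.
  by apply/eqP; rewrite eqn_leq a_gt0 andbT -aj a_nondecreasing.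
split=> [k3|dk i1 i2 i1k i2k].
  have kd : (k <= d)%N by apply/bigmax_leqP => i _; apply: ltn_ord.
  have d3 : (2 < d)%N := leq_trans k3 kd.
  pose i0 := Ordinal (ltnW (ltnW d3)); pose i1 := Ordinal (ltnW d3); pose i2 := Ordinal d3.
  have i12 : i1 \notin [set i2] by rewrite inE.
  have i012 : i0 \notin i1 |: [set i2] by rewrite !inE.
  have -> : 4%N = (2 * \sum_(r in i0 |: (i1 |: [set i2])) a r - 2)%N.
    rewrite big_setU1 //= big_setU1 //= big_set1.
    by rewrite !a_before //; apply: leq_trans k3.
  apply: (@product_not_propertyN _ d n a _ i0 i2) => //; rewrite ?inE ?eqxx ?orbT //.
    move=> r; rewrite !inE => /or3P[] /eqP -> //.
  by left; rewrite !cardsU1 i12 i012 cards1.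
have i12 : (i1 < i2)%N by rewrite i1k i2k.
have i12n : i1 \notin [set i2] by rewrite inE -val_eqE /= neq_ltn i12.
have -> : (2 * a i1 + 2 * a i2 - 2 = 2 * \sum_(r in i1 |: [set i2]) a r - 2)%N.
  by rewrite big_setU1 //= big_set1 mulnDr.
apply: (@product_not_propertyN _ d n a _ i1 i2) => //; rewrite ?inE ?eqxx ?orbT //.
  by move=> r; rewrite !inE => /orP[] /eqP ->; rewrite leqnn ltnW.
by right; split; apply: a_after; rewrite ?i1k ?i2k.
Qed.
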